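(* Let $k,n\ge 1$, let $\bar z=(z_1,\dots,z_k)\in\mathbb C^k$ have pairwise distinct entries and let $\bar\alpha=(\alpha_1,\dots,\alpha_n)\in\mathbb C^n$ have pairwise distinct entries. Let $\pi^{\langle n\rangle}_{\bar z}:U(\mathfrak{gl}_n[t])\to\operatorname{End}(\mathfrak P_{kn})$ and $\pi^{\langle k\rangle}_{-\bar\alpha}:U(\mathfrak{gl}_k[t])\to\operatorname{End}(\mathfrak P_{kn})$ be the homomorphisms determined by $$\pi^{\langle n\rangle}_{\bar z}(e^{\langle n\rangle}_{ij}\otimes t^s)=\sum_{a=1}^k z_a^s\,\xi_{ai}\partial_{aj},\qquad \pi^{\langle k\rangle}_{-\bar\alpha}(e^{\langle k\rangle}_{ab}\otimes t^s)=\sum_{i=1}^n(-\alpha_i)^s\,\xi_{ai}\partial_{bi}.$$ Then $\pi^{\langle n\rangle}_{\bar z}\bigl(\mathcal B^{\langle n\rangle}_{\bar\alpha}\bigr)=\pi^{\langle k\rangle}_{-\bar\alpha}\bigl(\mathcal B^{\langle k\rangle}_{\bar z}\bigr)$.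
   Context: $\mathfrak P_{kn}$ is the space of polynomials in $kn$ pairwise anticommuting variables $\xi_{ai}$ ($a=1,\dots,k$, $i=1,\dots,n$), so $\xi_{ai}\xi_{bj}=-\xi_{bj}\xi_{ai}$ and $\xi_{ai}^2=0$. The left derivation $\partial_{ai}$ is the linear map sending a monomial $\xi_{c_1}\cdots\xi_{c_l}$ (each $c_r$ a double index) to $(-1)^{s-1}\xi_{c_1}\cdots\xi_{c_{s-1}}\xi_{c_{s+1}}\cdots\xi_{c_l}$ if $c_s=(a,i)$ for some $s$, and to $0$ otherwise. For $N\ge1$, $\mathfrak{gl}_N[t]=\mathfrak{gl}_N\otimes\mathbb C[t]$ with pointwise bracket; $e_{ij}$ ($i,j=1,\dots,N$) are the standard generators of $\mathfrak{gl}_N$, $[e_{ij},e_{kl}]=\delta_{jk}e_{il}-\delta_{il}e_{kj}$; superscripts $\langle n\rangle,\langle k\rangle$ indicate $N=n$ or $N=k$. For $g\in\mathfrak{gl}_N$ put $g(x)=\sum_{s\ge0}(g\otimes t^s)x^{-s-1}$. For an $N\times N$ matrix $A=(a_{ij})$ with noncommuting entries, $\operatorname{rdet}A=\sum_{\sigma\in S_N}(-1)^\sigma a_{1\sigma(1)}\cdots a_{N\sigma(N)}$. For a sequence $\bar\beta=(\beta_1,\dots,\beta_N)$ of pairwise distinct complex numbers, the universal differential operator is $\mathcal D_{\bar\beta}=\operatorname{rdet}\bigl((\tfrac{d}{dx}-\beta_i)\delta_{ij}-e_{ji}(x)\bigr)_{i,j=1}^N$; writing it with all powers of $d/dx$ on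 the right, $\mathcal D_{\bar\beta}=(d/dx)^N+\sum_{i=1}^N B_i(x)(d/dx)^{N-i}$ with $B_i(x)=\sum_{j\ge0}B_{ij}x^{-j}$, $B_{ij}\in U(\mathfrak{gl}_N[t])$. The Bethe algebra $\mathcal B^{\langle N\rangle}_{\bar\beta}\subset U(\mathfrak{gl}_N[t])$ is the subalgebra generated by $B_{ij}$, $i=1,\dots,N$, $j\ge1$. *)

(* Defs.v *)
From HB Require Import structures.
From mathcomp Require Import all_boot all_order all_algebra all_fingroup.
From mathcomp Require Import complex.
From mathcomp Require Import Rstruct.
Set Implicit Arguments.
Unset Strict Implicit.
Unset Printing Implicit Defensive.
Import Order.TTheory GRing.Theory Num.Theory.
Local Open Scope ring_scope.

Notation C := (Rdefinitions.R)[i].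

(* Generic construction of the coefficients B_{ij} of the universal     *)
(* differential operator, over an arbitrary ring A, given the images    *)
(* E i j s in A of the generators e_{ij} (x) t^s and the images beta i  *)
(* in A of the scalars beta_i.                                          *)
(* A formal series in y = x^{-1} with coefficients in A is nat -> A     *)
(* (coefficient of x^{-j}).  A differential operator with all powers of *)
(* d/dx on the right is a seq of series: the m-th entry is the          *)
(* coefficient of (d/dx)^m.                                             *)
Section DiffOp.
Variable A : pzRingType.

Definition series := nat -> A.
Definition sr0 : series := fun _ => 0.
Definition sr1 : series := fun j => if j == 0%N then 1 else 0.

(* d/dx acting on a series: d/dx x^{-j} = -j x^{-j-1} *)
Definition sderiv (f : series) : series :=
  fun j => if j is j'.+1 then - (f j' *+ j') else 0.
Definition sderivn (r : nat) (f : series) : series := iter r sderiv f.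

Definition smul (f g : series) : series :=
  fun j => \sum_(u < j.+1) f u * g (j - u)%N.

Definition dop := seq series.
Definition dcoef (P : dop) (m : nat) : series := nth sr0 P m.

Definition dadd (P Q : dop) : dop :=
  mkseq (fun p j => dcoef P p j + dcoef Q p j) (maxn (size P) (size Q)).
Definition dopp (P : dop) : dop := map (fun f j => - f j) P.
Definition d0 : dop := [::].
Definition d1 : dop := [:: sr1].

(* (a d^m)(b d^l) = sum_r binom(m,r) a b^{(r)} d^{m+l-r} *)
Definition dmul (P Q : dop) : dop :=
  mkseq (fun p j =>
    \sum_(m < size P) \sum_(l < size Q) \sum_(r < m.+1)
      if (m + l - r == p)%N
      then smul (dcoef P m) (sderivn r (dcoef Q l)) j *+ 'C(m, r)
      else 0)
    (size P + size Q).

Definition drdet (N : nat) (M : 'I_N -> 'I_N -> dop) : dop :=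
  foldr dadd d0
    [seq (if odd_perm s then dopp else id)
           (foldr dmul d1 [seq M i (s i) | i <- enum 'I_N])
    | s <- enum {perm 'I_N}].

(* the matrix ((d/dx - beta_i) delta_ij - e_ji(x))_{ij},
   where e_ji(x) = sum_s (e_ji (x) t^s) x^{-s-1} *)
Definition ser_e (N : nat) (E : 'I_N -> 'I_N -> nat -> A) (i j : 'I_N) : series :=
  fun y => if y is s.+1 then E i j s else 0.

Definition bethe_matrix (N : nat) (beta : 'I_N -> A)
    (E : 'I_N -> 'I_N -> nat -> A) (i j : 'I_N) : dop :=
  if i == j then
    [:: (fun y => (if y == 0%N then - beta i else 0) - ser_e E j i y); sr1]
  else [:: (fun y => - ser_e E j i y)].

(* D_beta = (d/dx)^N + sum_i B_i(x) (d/dx)^{N-i},  B_i(x) = sum_j B_ij x^{-j} *)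
Definition bethe_coeff (N : nat) (beta : 'I_N -> A)
    (E : 'I_N -> 'I_N -> nat -> A) (i j : nat) : A :=
  dcoef (drdet (bethe_matrix beta E)) (N - i) j.

Definition bethe_gens (N : nat) (beta : 'I_N -> A)
    (E : 'I_N -> 'I_N -> nat -> A) (a : A) : Prop :=
  exists i j : nat, [/\ (1 <= i <= N)%N, (1 <= j)%N & a = bethe_coeff beta E i j].

End DiffOp.

(* The Grassmann algebra P_{kn} and the operators xi_{ai}, d_{ai}.      *)
(* Basis: monomials xi_{c_1} ... xi_{c_l} with c_1 < ... < c_l (order   *)
(* given by enum_rank), indexed by subsets of 'I_k * 'I_n.  End(P_{kn}) *)
(* is the matrix ring 'M[C]_(#|{set 'I_k * 'I_n}|): the entry (p, q) is *)
(* the coefficient of basis element p in the image of basis element q.  *)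
Notation EndP k n := (matrix C #|{set (prod (ordinal k) (ordinal n))}| #|{set (prod (ordinal k) (ordinal n))}|).
Section Grassmann.
Variables k n : nat.
Local Notation dbl := (prod (ordinal k) (ordinal n)).
Local Notation gdim := #|{set dbl}|.
Local Notation EndP := (EndP k n).

Definition rk (c : dbl) : nat := enum_rank c.
Definition nbefore (S : {set dbl}) (c : dbl) : nat :=
  #|[set s in S | (rk s < rk c)%N]|.

(* left multiplication by xi_c *)
Definition xi_op (c : dbl) : EndP :=
  \matrix_(p < gdim, q < gdim)
    (let S' : {set dbl} := enum_val p in let S : {set dbl} := enum_val q in
     if (c \notin S) && (S' == c |: S) then (-1) ^+ nbefore S c else 0).

(* left derivation d_c *)
Definition del_op (c : dbl) : EndP :=
  \matrix_(p < gdim, q < gdim)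
    (let S' : {set dbl} := enum_val p in let S : {set dbl} := enum_val q in
     if (c \in S) && (S' == S :\ c) then (-1) ^+ nbefore S c else 0).

Definition pi_n (z : 'I_k -> C) (i j : 'I_n) (s : nat) : EndP :=
  \sum_(a < k) (z a ^+ s) *: (xi_op (a, i) *m del_op (a, j)).

Definition pi_k (alpha : 'I_n -> C) (a b : 'I_k) (s : nat) : EndP :=
  \sum_(i < n) ((- alpha i) ^+ s) *: (xi_op (a, i) *m del_op (b, i)).
End Grassmann.

Inductive gen_alg (d : nat) (S : 'M[C]_d -> Prop) : 'M[C]_d -> Prop :=
| ga_gen x : S x -> gen_alg S x
| ga_one : gen_alg S 1%:M
| ga_add x y : gen_alg S x -> gen_alg S y -> gen_alg S (x + y)
| ga_scale (c : C) x : gen_alg S x -> gen_alg S (c *: x)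
| ga_mul x y : gen_alg S x -> gen_alg S y -> gen_alg S (x *m y).

(* Main.v *)
(* Put P_i = d/dx - alpha_i, X_a = x - z_a, and let D be the universal operator
   of gl_n. Let N be the universal operator of gl_k after the substitution
   x -> - d/dx, d/dx -> x. Among pseudodifferential operators, i.e. series in
   1/x and (d/dx)^-1, one has
     D * (prod_i P_i)^-1 * N = prod_a X_a.
   All other factors have scalar coefficients, so the coefficients of D are
   polynomials in those of N, and conversely.

   For the identity, adjoin anticommuting variables psi_i, om_a. The rows of the
   two matrices become
     phi_i = P_i psi_i + sum_a t_a d_ai,  t_a = X_a^-1 * sum_j xi_aj psi_j,
     chi_a = X_a om_a - sum_i d_ai s_i,   s_i = P_i^-1 * sum_b xi_bi om_b
   (the latter up to conjugation by prod_i P_i), and their products are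
   det * prod psi and det * prod om. Since t_a commutes with all the phi_i, the
   factors chi_a can be absorbed one at a time: prod phi_i * chi_a turns into
   X_a * prod phi'_i * om_a, where phi'_i is phi_i without its term t_a d_ai.

   Series are replaced by nilpotent expansions: x and d/dx are scaled by a
   central h with h^(d+1) = 0, so that [h d/dx, h x] = h^2, and h x, h d/dx
   act as units on a space of arrays. *)
Require Import Defs.
From HB Require Import structures.
From mathcomp Require Import all_boot all_order all_algebra all_fingroup.
From mathcomp Require Import complex Rstruct.
From mathcomp Require Import boolp zify.
Set Implicit Arguments.
Unset Strict Implicit.
Unset Printing Implicit Defensive.
Import GRing.Theory.
Local Open Scope ring_scope.

(** * Equations in abelian groups *)

(** The substitution x -> - d/dx is dictated by the poles: the series of the gl_k generators sum to
    multiples of 1 / (x + alpha_i), which become multiples of - P_i^-1, so both matrices are written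
    in the same P_i and X_a. The factor (prod_i P_i)^-1 compensates for an ordering: the gl_k matrix
    contains xi d, whereas the absorption argument needs d xi.

    The obstacle is to give D, N and their inverses a meaning in one ring, since infinitely many
    powers of 1/x and (d/dx)^-1 occur at once. A nilpotent h makes every expansion finite and makes
    D and N nilpotent perturbations of units; d is chosen for each generator so large that its
    coefficient is not cut off.

    That one set of coefficients is polynomial in the other is never made explicit. The operators
    preserving the arrays with entries in a given subalgebra form a subring, closed under the
    inverses that occur; the identity is solved for D inside it, and evaluating D on one array puts
    its coefficients in the subalgebra. *)

(* [ring] requires commutativity; [abel] decides the equations that hold in
   every abelian group, with products as atoms. *)
Inductive zexpr := ZAtom of nat | ZZero | ZAdd of zexpr & zexpr | ZOpp of zexpr.

Fixpoint zeval (V : zmodType) (env : seq V) (e : zexpr) : V :=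
  match e with
  | ZAtom i => env`_i
  | ZZero => 0
  | ZAdd e1 e2 => zeval env e1 + zeval env e2
  | ZOpp e1 => - zeval env e1
  end.

Fixpoint zcoef (e : zexpr) (i : nat) : int :=
  match e with
  | ZAtom j => if j == i then 1 else 0
  | ZZero => 0
  | ZAdd e1 e2 => zcoef e1 i + zcoef e2 i
  | ZOpp e1 => - zcoef e1 i
  end.

Lemma zeval_coef (V : zmodType) (env : seq V) e :
  zeval env e = \sum_(i < size env) env`_i *~ zcoef e i.
Proof.
elim: e => [j||e1 IH1 e2 IH2|e IH] /=.
- case: (ltnP j (size env)) => [lt_j|le_j].
    rewrite (bigD1 (Ordinal lt_j)) //= eqxx mulr1z big1 ?addr0 // => i ij.
    by rewrite ifN // eq_sym.
  rewrite nth_default // big1 // => i _; rewrite ifN // neq_ltn.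
  by rewrite (leq_trans (ltn_ord i) le_j) orbT.
- by rewrite big1.
- by rewrite IH1 IH2 -big_split; apply: eq_bigr => i _; rewrite mulrzDr.
- by rewrite IH -sumrN; apply: eq_bigr => i _; rewrite mulrNz.
Qed.

Lemma zeval_eq (V : zmodType) (env : seq V) e1 e2 :
  all (fun i => zcoef e1 i == zcoef e2 i) (iota 0 (size env)) ->
  zeval env e1 = zeval env e2.
Proof.
move=> /allP eq12; rewrite !zeval_coef; apply: eq_bigr => i _.
by rewrite (eqP (eq12 i _)) // mem_iota ltn_ord.
Qed.

Ltac zindex x env :=
  match env with
  | ?y :: _ => let _ := match tt with _ => unify x y end in constr:(0%N)
  | _ :: ?env' => let n := zindex x env' in constr:(n.+1)
  end.

Ltac zatoms env e :=
  lazymatch e with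
  | (?a + ?b)%R => let env' := zatoms env a in zatoms env' b
  | (- ?a)%R => zatoms env a
  | 0%R => env
  | _ => match env with
         | _ => let _ := zindex e env in env
         | _ => constr:(e :: env)
         end
  end.

Ltac zreify env e :=
  lazymatch e with
  | (?a + ?b)%R =>
      let a' := zreify env a in let b' := zreify env b in constr:(ZAdd a' b')
  | (- ?a)%R => let a' := zreify env a in constr:(ZOpp a')
  | 0%R => constr:(ZZero)
  | _ => let n := zindex e env in constr:(ZAtom n)
  end.

Ltac abel :=
  lazymatch goal with
  | |- @eq ?T ?a ?b =>
      let env := zatoms (@nil T) a in
      let env := zatoms env b in
      let a' := zreify env a in
      let b' := zreify env b in
      refine (@zeval_eq _ env a' b' _); vm_compute; reflexivity
  end.

(** * Products of anticommuting elements *)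

Section SignRules.
Variable L : pzRingType.
Implicit Types a b u : L.

Lemma mulr_anti_sign a b u k : b * a = - (a * b) ->
  b * ((-1) ^+ k * (a * u)) = (-1) ^+ k.+1 * (a * (b * u)).
Proof.
have bC : b * (-1) ^+ k = (-1) ^+ k * b := commr_sign b k.
move=> ba; rewrite [LHS]mulrA bC -mulrA [b * (a * u)]mulrA ba mulNr.
by rewrite exprS mulN1r mulNr mulrN -!mulrA.
Qed.

Lemma prod_anti_move (I : Type) (psi : I -> L) a (s : seq I) :
  (forall i, psi i * a = - (a * psi i)) ->
  (\prod_(i <- s) psi i) * a = (-1) ^+ size s * (a * \prod_(i <- s) psi i).
Proof.
move=> aN; elim: s => [|i s IHs]; first by rewrite big_nil !mul1r mulr1.
by rewrite big_cons -mulrA IHs mulr_anti_sign.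
Qed.

Lemma anti_anti_comm a b u : a * u = - (u * a) -> b * u = - (u * b) ->
  GRing.comm u (a * b).
Proof. by move=> au bu; rewrite /GRing.comm -mulrA bu mulrN !mulrA au mulNr opprK. Qed.

Lemma comm_inv a b u : b * a = 1 -> a * b = 1 -> GRing.comm u a -> GRing.comm u b.
Proof.
move=> ba ab ua; rewrite /GRing.comm -[LHS]mul1r -ba -mulrA (mulrA a) -ua.
by rewrite -mulrA ab mulr1.
Qed.
End SignRules.

(** * Products of an anticommuting family perturbed by multiples of [t] *)

Section GeneratingProduct.
Variables (L : pzRingType) (I : eqType) (phi d : I -> L).

(* The coefficient of [t ^ m] in the product of the [phi i + t * d i], for a
   central [t]. *)
Fixpoint gprod (s : seq I) (m : nat) : L :=
  if s is i :: s' then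
    phi i * gprod s' m + (if m is m'.+1 then d i * gprod s' m' else 0)
  else (m == 0%N)%:R.

Lemma gprod_gt s m : (size s < m)%N -> gprod s m = 0.
Proof.
elim: s m => [|i s IHs] [|m] //= lt_s_m.
by rewrite !IHs ?mulr0 ?addr0 // ltnW.
Qed.

Lemma gprod0 s : gprod s 0 = \prod_(i <- s) phi i.
Proof. by elim: s => [|i s IHs] /=; rewrite ?big_nil // big_cons IHs addr0. Qed.

Lemma prod_gprod t s : (forall i, t * (phi i + t * d i) = (phi i + t * d i) * t) ->
  \prod_(i <- s) (phi i + t * d i) = \sum_(m < (size s).+1) t ^+ m * gprod s m.
Proof.
move=> tC; have tXC m i : (phi i + t * d i) * t ^+ m = t ^+ m * (phi i + t * d i).
  by apply: commrX; symmetry; apply: tC.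
elim: s => [|i s IHs]; first by rewrite big_nil big_ord1 mulr1.
rewrite big_cons IHs mulr_sumr.
have E m : (phi i + t * d i) * (t ^+ m * gprod s m) =
    t ^+ m * (phi i * gprod s m) + t ^+ m.+1 * (d i * gprod s m).
  by rewrite mulrA tXC -mulrA mulrDl mulrDr -(mulrA t) exprSr -[t ^+ m * t * _]mulrA.
under eq_bigr => m _ do rewrite E.
have E' (m : 'I_(size s).+1) : t ^+ m.+1 * gprod (i :: s) m.+1 =
    t ^+ m.+1 * (phi i * gprod s m.+1) + t ^+ m.+1 * (d i * gprod s m).
  by rewrite -mulrDr.
rewrite big_split [RHS]big_ord_recl [gprod (i :: s) _]/= addr0 expr0 mul1r.
under [X in _ = _ + X]eq_bigr => m _ do rewrite E'.
rewrite big_split /= addrA; congr (_ + _).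
rewrite -[phi i * gprod s 0]mul1r -(expr0 t).
rewrite -(big_ord_recl (size s).+1 (fun m => t ^+ m * (phi i * gprod s m))).
by rewrite [RHS]big_ord_recr /= gprod_gt // !mulr0 addr0.
Qed.

Hypothesis phiN : forall i j, phi i * phi j = - (phi j * phi i).
Hypothesis phi2 : forall i, phi i * phi i = 0.
Hypothesis dN : forall i j, d i * d j = - (d j * d i).
Hypothesis d2 : forall i, d i * d i = 0.
Hypothesis phidN : forall i j, phi i * d j = - (d j * phi i).

(** For a central [t] the elements [phi i + t * d i] anticommute and square to zero. Comparing
    coefficients of [t ^ m] gives this lemma and the next two. *)
Lemma gprod_swap i j s m : gprod [:: i, j & s] m = - gprod [:: j, i & s] m.
Proof.
have E (a b u : L) : a * b = - (b * a) -> a * (b * u) = - (b * (a * u)).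
  by move=> ab; rewrite !mulrA ab mulNr.
have dphi a b : d a * phi b = - (phi b * d a) by rewrite phidN opprK.
case: m => [|[|m]] /=; rewrite ?mulrDr ?mulr0 ?addr0 !(E _ _ _ (phiN i j)) //.
  by rewrite !(E _ _ _ (phidN i j)) !(E _ _ _ (dphi i j)); abel.
rewrite !(E _ _ _ (phidN i j)) !(E _ _ _ (dphi i j)) !(E _ _ _ (dN i j)); abel.
Qed.

Lemma gprod_dup i s m : gprod [:: i, i & s] m = 0.
Proof.
have E (a u : L) : a * a = 0 -> a * (a * u) = 0 :> L by move=> a2; rewrite mulrA a2 mul0r.
have F u : d i * (phi i * u) = - (phi i * (d i * u)).
  by rewrite !mulrA phidN mulNr opprK.
case: m => [|[|m]] /=; rewrite ?mulrDr ?mulr0 ?addr0 !(E _ _ (phi2 i)) ?add0r //.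
  by rewrite F addrN.
by rewrite F !(E _ _ (d2 i)) addr0 addrN.
Qed.

Lemma gprod_mem i s m : i \in s -> gprod (i :: s) m = 0.
Proof.
elim: s m => [|j s IHs] m //; rewrite inE => /orP[/eqP->|i_s].
  exact: gprod_dup.
rewrite gprod_swap; apply/eqP; rewrite oppr_eq0; apply/eqP.
rewrite -[LHS]/(phi j * gprod (i :: s) m +
  (if m is m'.+1 then d j * gprod (i :: s) m' else 0)).
by case: m => [|m]; rewrite !IHs // ?mulr0 addr0 ?mulr0.
Qed.

Lemma gprod_anti a s m : (forall i, phi i * a = - (a * phi i)) ->
  (forall i, d i * a = - (a * d i)) ->
  gprod s m * a = (-1) ^+ size s * (a * gprod s m).
Proof.
move=> pa da; elim: s m => [|i s IHs] m /=.
  by case: (m == 0%N); rewrite ?mul0r ?mulr0 ?mulr1 ?mul1r.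
rewrite mulrDl mulrDr -!mulrA IHs mulr_anti_sign // mulrDr; congr (_ + _).
by case: m => [|m]; rewrite ?mul0r ?mulr0 // -mulrA IHs mulr_anti_sign.
Qed.

(** The left side is the coefficient of [t ^ m.+1] in the product over [s] times [phi l + t * d l],
    a product with a repeated factor. *)
Lemma gprodS_phi_d s m l : l \in s -> gprod s m.+1 * phi l + gprod s m * d l = 0.
Proof.
move=> ls; rewrite !gprod_anti // => [|i]; last by rewrite phidN opprK.
by rewrite -mulrDr -[_ + _]/(gprod (l :: s) m.+1) gprod_mem // mulr0.
Qed.

Variables (X U : L) (psi : I -> L).
Hypothesis phiX : forall i, phi i * X = X * phi i + psi i.
Hypothesis dU : forall i, d i * U = U * d i + psi i.
Hypothesis phiU : forall i, phi i * U = U * phi i.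
Hypothesis dX : forall i, d i * X = X * d i.

Lemma gprod_comm0 s : gprod s 0 * U = U * gprod s 0.
Proof.
elim: s => [|i s IHs] /=; first by rewrite mulr1 mul1r.
by rewrite addr0 -mulrA IHs !mulrA phiU.
Qed.

(** For a central [t] each [phi i + t * d i] commutes with [t * X - U]: the term [t * psi i] from
    [phi i] and [X] cancels the one from [d i] and [U]. The equation is the coefficient of
    [t ^ m.+1] in this commutation for the whole product; [gprod_comm0] is the constant one. *)
Lemma gprod_comm s m :
  gprod s m * X + U * gprod s m.+1 = X * gprod s m + gprod s m.+1 * U.
Proof.
elim: s m => [|i s IHs] m /=.
  by rewrite mulr0 mul0r addr0; case: (m == 0%N); rewrite ?mulr1 ?mul1r ?mul0r ?mulr0 addr0.
have XP u : X * (phi i * u) = phi i * (X * u) - psi i * u.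
  by rewrite !mulrA phiX mulrDl addrK.
have Xd u : X * (d i * u) = d i * (X * u) by rewrite !mulrA dX.
have UP u : U * (phi i * u) = phi i * (U * u) by rewrite !mulrA phiU.
have Ud u : U * (d i * u) = d i * (U * u) - psi i * u.
  by rewrite !mulrA dU mulrDl addrK.
case: m => [|m]; rewrite ?addr0 !mulrDr !mulrDl -!mulrA XP ?Xd UP Ud ?gprod_comm0.
  have := congr1 ( *%R (phi i)) (IHs 0%N); rewrite !mulrDr => E.
  have {E}-> := canRL (addrK _) E; abel.
have := congr1 ( *%R (phi i)) (IHs m.+1); rewrite !mulrDr => E.
have {E}-> := canRL (addrK _) E.
have := congr1 ( *%R (d i)) (IHs m); rewrite !mulrDr => E.
have {E}-> := canRL (addrK _) E; abel.
Qed.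

Variable Xi : L.
Hypothesis XK : X * Xi = 1.
Hypothesis XiK : Xi * X = 1.
Hypothesis XU : X * U = U * X.
Hypothesis psiX : forall i, psi i * X = X * psi i.
Hypothesis psiU : forall i, psi i * U = U * psi i.
Local Notation t := (Xi * U).

Let Xt : X * t = U. Proof. by rewrite mulrA XK mul1r. Qed.
Let tX : t * X = U. Proof. by rewrite -mulrA -XU mulrA XiK mul1r. Qed.

(** The cancellation of [gprod_comm] at the value of [t] where [t * X - U] vanishes: the corrections
    from moving [phi i] past [Xi] and [d i] past [U] are equal and opposite. *)
Lemma pert_comm i : t * (phi i + t * d i) = (phi i + t * d i) * t.
Proof.
have UXi : GRing.comm U Xi by apply: (comm_inv XiK XK).
have psiXi : GRing.comm (psi i) Xi by apply: (comm_inv XiK XK).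
have dXi : GRing.comm (d i) Xi by apply: (comm_inv XiK XK).
have phiXi : phi i * Xi = Xi * phi i - Xi * (Xi * psi i).
  have E : X * phi i = phi i * X - psi i by rewrite phiX addrK.
  by rewrite -[LHS]mul1r -XiK -mulrA (mulrA X) E mulrBl -mulrA XK mulr1 psiXi mulrBr.
have tt : t * t = Xi * (Xi * (U * U)) by rewrite -!mulrA [U * _]mulrA UXi -!mulrA.
rewrite mulrDr mulrDl [t * (t * _)]mulrA tt.
have -> : phi i * t = Xi * (U * phi i) - Xi * (Xi * (U * psi i)).
  by rewrite mulrA phiXi mulrBl -!mulrA phiU psiU.
have -> : t * d i * t = Xi * (Xi * (U * (U * d i))) + Xi * (Xi * (U * psi i)).
  rewrite -!mulrA [d i * _]mulrA dXi -[Xi * d i * U]mulrA dU !mulrDr.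
  by rewrite ![U * (Xi * _)]mulrA UXi -!mulrA.
rewrite -!mulrA; abel.
Qed.

(** Lets perturbations be iterated: the new family anticommutes as the old one did, because [t]
    commutes with every factor and its powers can be collected on the left. *)
Lemma pert_anti i j :
  (phi i + t * d i) * (phi j + t * d j) = - ((phi j + t * d j) * (phi i + t * d i)).
Proof.
have E (u : L) a b : u * (phi a + u * d a) = (phi a + u * d a) * u ->
    (phi a + u * d a) * (phi b + u * d b) =
    phi a * phi b + u * (d a * phi b + phi a * d b) + u * (u * (d a * d b)).
  move=> uC; rewrite mulrDr [_ * (u * _)]mulrA -uC -(mulrA u) !mulrDl !mulrDr -!mulrA; abel.
rewrite !E ?pert_comm // (dN j i) (phiN j i) (phidN j i) (phidN i j) !(mulrN, mulrDr); abel.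
Qed.

(* Although [t] is not central, it commutes with each factor, so the product is
   the sum of the [t ^ m * gprod s m]; multiplication by [c] turns its [m]-th
   term into a difference of consecutive terms, and the sum telescopes. *)
Lemma prod_telescope s (g : I -> L) (w c : L) :
  c = X * w - \sum_(i <- s) d i * g i ->
  \sum_(i <- s) phi i * g i = - (U * w) ->
  (\prod_(i <- s) (phi i + t * d i)) * c = X * (\prod_(i <- s) phi i) * w.
Proof.
have := pert_comm; have := tX; have := Xt.
set t := Xi * U; clearbody t => Xt' tX' tC cE gE.
have step m : gprod s m * c = (X * gprod s m - U * gprod s m.+1) * w.
  (* [gprodS_phi_d] trades [gprod s m * d i] for [- gprod s m.+1 * phi i], which leads to the sum
     known from [gE]. *)
  have: gprod s m * (\sum_(i <- s) d i * g i) = gprod s m.+1 * (U * w).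
    rewrite -[RHS]opprK -mulrN -gE !mulr_sumr -sumrN big_seq [RHS]big_seq.
    apply: eq_bigr => i i_s; rewrite !mulrA -mulNr; congr (_ * _).
    by apply/eqP; rewrite -addr_eq0 addrC gprodS_phi_d.
  rewrite cE mulrBr => ->; rewrite !mulrA -mulrBl; congr (_ * _).
  by have := gprod_comm s m => /(canRL (addrK _)) ->; abel.
have tXX m : t ^+ m * X = X * t ^+ m.
  by symmetry; apply: commrX; rewrite /GRing.comm Xt' tX'.
rewrite prod_gprod // mulr_suml.
have E m : t ^+ m * gprod s m * c =
    (X * t ^+ m * gprod s m - X * t ^+ m.+1 * gprod s m.+1) * w.
  by rewrite -mulrA step mulrA mulrBr !mulrA -tX' !mulrA -exprSr !tXX.
rewrite (eq_bigr _ (fun (m : 'I__) _ => E m)) -mulr_suml; congr (_ * _).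
have -> : \sum_(m < (size s).+1) (X * t ^+ m * gprod s m - X * t ^+ m.+1 * gprod s m.+1)
   = - \sum_(0 <= m < (size s).+1) (X * t ^+ m.+1 * gprod s m.+1 - X * t ^+ m * gprod s m).
  by rewrite big_mkord -sumrN; apply: eq_bigr => m _; rewrite opprB.
rewrite telescope_sumr // gprod_gt // mulr0 sub0r opprK expr0 mulr1.
by rewrite gprod0.
Qed.
End GeneratingProduct.

(** * Row determinants *)

Section AnticommutingProducts.
Variables (L : pzRingType) (n : nat) (psi : 'I_n -> L).
Hypothesis psiN : forall i j, psi i * psi j = - (psi j * psi i).
Hypothesis psi2 : forall i, psi i * psi i = 0.

Lemma prod_anti_mem (s : seq 'I_n) i : i \in s -> psi i * \prod_(j <- s) psi j = 0.
Proof.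
elim: s => // j s IHs; rewrite inE big_cons mulrA => /orP[/eqP<-|/IHs E].
  by rewrite psi2 mul0r.
by rewrite psiN mulNr -mulrA E mulr0 oppr0.
Qed.

Lemma prod_anti_dup (s : seq 'I_n) : ~~ uniq s -> \prod_(i <- s) psi i = 0.
Proof.
elim: s => //= i s IHs; rewrite negb_and negbK big_cons => /orP[|/IHs->].
  exact: prod_anti_mem.
by rewrite mulr0.
Qed.

Lemma prod_anti_swap (a b c : seq 'I_n) i j :
  \prod_(x <- a ++ i :: b ++ j :: c) psi x =
  - \prod_(x <- a ++ j :: b ++ i :: c) psi x.
Proof.
have E k (u : L) : (\prod_(x <- b) psi x) * (psi k * u) =
    (-1) ^+ size b * (psi k * (\prod_(x <- b) psi x * u)).
  by rewrite mulrA prod_anti_move // -!mulrA.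
have C k (u : L) : psi k * ((-1) ^+ size b * u) = (-1) ^+ size b * (psi k * u).
  by rewrite mulrA (commr_sign (psi k) (size b) : _ * _ = _) -mulrA.
rewrite !big_cat /= !big_cons !big_cat /= !big_cons -mulrN; congr (_ * _).
rewrite !E !C -mulrN; congr (_ * _); rewrite !mulrA -!mulNr; congr (_ * _ * _).
by rewrite psiN mulNr.
Qed.

Lemma prod_anti_tperm (f : 'I_n -> 'I_n) (s : seq 'I_n) x y :
  uniq s -> x \in s -> y \in s -> x != y ->
  \prod_(i <- s) psi (f (tperm x y i)) = - \prod_(i <- s) psi (f i).
Proof.
have key (a b c : seq 'I_n) u v : uniq (a ++ u :: b ++ v :: c) ->
   \prod_(i <- a ++ u :: b ++ v :: c) psi (f (tperm u v i)) =
   - \prod_(i <- a ++ u :: b ++ v :: c) psi (f i).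
  move=> Us; have Ut t : uniq (u :: v :: t) ->
      [seq f (tperm u v i) | i <- t] = [seq f i | i <- t].
    rewrite /= inE negb_or => /and3P[/andP[_ ut] vt _].
    by apply/eq_in_map => i it; rewrite tpermD //; [apply: contraNneq ut|apply: contraNneq vt] => ->.
  have U3 : uniq (u :: v :: a ++ b ++ c).
    rewrite -(perm_uniq (s1 := a ++ u :: b ++ v :: c)) //.
    by apply/seq.permP => p; rewrite /= !count_cat /= !count_cat /=; lia.
  have sub3 t : subseq t (a ++ b ++ c) -> uniq (u :: v :: t).
    by move=> tS; apply: subseq_uniq U3; rewrite /= !eqxx.
  rewrite -!(big_map (fun i => f _) xpredT psi) !map_cat /= !map_cat /=.
  rewrite tpermL tpermR !Ut; first exact: prod_anti_swap; apply: sub3.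
  - by rewrite catA suffix_subseq.
  - by apply: (subseq_trans (prefix_subseq b c)); apply: suffix_subseq.
  - exact: prefix_subseq.
move=> Us xs ys xy; case/splitPr: xs Us ys => p1 p2 Us.
rewrite mem_cat inE eq_sym (negPf xy) /= => /orP[] ys.
  case/splitPr: ys Us => q1 q2; rewrite -catA /= => Us.
  by under eq_bigr => i _ do rewrite tpermC; apply: key.
by case/splitPr: ys Us => q1 q2 Us; apply: key.
Qed.

Lemma prod_anti_perm (s : 'S_n) : \prod_i psi (s i) = (-1) ^+ s * \prod_i psi i.
Proof.
case: (prod_tpermP s) => ts -> {s}.
elim: ts => [|[x y] ts IHts] /=.
  move=> _; rewrite big_nil odd_perm1 mul1r.
  by apply: eq_bigr => i _; rewrite perm1.
case/andP; rewrite /dpair /= => xy /IHts {}IHts.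
rewrite big_cons odd_mul_tperm xy signr_addb expr1 mulN1r mulNr -IHts.
under eq_bigr => i _ do rewrite permM.
by rewrite prod_anti_tperm // ?mem_index_enum // index_enum_uniq.
Qed.

Definition rdet (R : pzRingType) m (M : 'I_m -> 'I_m -> R) : R :=
  \sum_(s : 'S_m) (-1) ^+ s * \prod_i M i (s i).

(** Only the [psi j] are moved; the entries stay in row order, so the row determinant appears
    although they do not commute with each other. A choice of columns with a repetition vanishes. *)
Lemma prod_rdet (M : 'I_n -> 'I_n -> L) :
  (forall i j l, M i j * psi l = psi l * M i j) ->
  \prod_i (\sum_j M i j * psi j) = rdet M * \prod_i psi i.
Proof.
move=> MC; rewrite bigA_distr_bigA /=.
have E (f : 'I_n -> 'I_n) (s : seq 'I_n) : \prod_(i <- s) (M i (f i) * psi (f i)) =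
    (\prod_(i <- s) M i (f i)) * (\prod_(i <- s) psi (f i)).
  elim: s => [|i s IHs]; first by rewrite !big_nil mulr1.
  rewrite !big_cons IHs -!mulrA; congr (_ * _); rewrite mulrA [RHS]mulrA.
  by congr (_ * _); apply: commr_prod => j _; apply/esym/MC.
rewrite (bigID (fun f : {ffun 'I_n -> 'I_n} => injectiveb f)) /= [X in _ + X]big1 ?addr0.
  rewrite (reindex (@pval _)) /=; last first.
    pose in_Sn := insubd (1%g : 'S_n).
    by exists in_Sn => /= f Uf; first apply: val_inj; apply: insubdK.
  rewrite mulr_suml; apply: eq_big => /= [s|s _]; first exact: (valP s).
  rewrite E !pvalE prod_anti_perm mulrA; congr (_ * _).
  exact: (commr_sign (\prod_i M i (s i)) s).
move=> f Uf; rewrite E -(big_map f xpredT psi) prod_anti_dup ?mulr0 //.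
have eI : perm_eq (index_enum 'I_n) (enum 'I_n).
  apply: uniq_perm; rewrite ?index_enum_uniq ?enum_uniq // => i.
  by rewrite mem_index_enum mem_enum.
by rewrite (perm_uniq (perm_map f eI)).
Qed.
End AnticommutingProducts.

(** * The duality of determinants *)

Section NormalOrdering.
Variables (L : pzRingType) (k n : nat).
Variables (P Pi psi : 'I_n -> L) (X Xi om : 'I_k -> L).
Variables (b d : 'I_k -> 'I_n -> L) (kap : L).
Implicit Types (a c r : 'I_k) (i j : 'I_n) (l : seq 'I_k).
Local Notation comm := GRing.comm.

Hypothesis tors : forall x : L, x = - x -> x = 0.
Hypothesis kapC : forall u, comm u kap.
Hypotheses (PK : forall i, P i * Pi i = 1) (PiK : forall i, Pi i * P i = 1).
Hypotheses (XK : forall a, X a * Xi a = 1) (XiK : forall a, Xi a * X a = 1).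
Hypotheses (PP : forall i j, comm (P i) (P j)) (XX : forall a c, comm (X a) (X c)).
Hypothesis PX : forall i a, P i * X a = X a * P i + kap.
Hypotheses (Ppsi : forall i j, comm (psi j) (P i)) (Pom : forall i a, comm (om a) (P i)).
Hypotheses (Pb : forall i a j, comm (b a j) (P i)) (Pd : forall i a j, comm (d a j) (P i)).
Hypotheses (Xpsi : forall a j, comm (psi j) (X a)) (Xom : forall a c, comm (om c) (X a)).
Hypotheses (Xb : forall a c j, comm (b c j) (X a)) (Xd : forall a c j, comm (d c j) (X a)).
Hypothesis psiN : forall i j, psi i * psi j = - (psi j * psi i).
Hypothesis omN : forall a c, om a * om c = - (om c * om a).
Hypothesis dN : forall a i c j, d a i * d c j = - (d c j * d a i).
Hypothesis bN : forall a i c j, b a i * b c j = - (b c j * b a i).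
Hypothesis psid : forall i a j, psi i * d a j = - (d a j * psi i).
Hypothesis psib : forall i a j, psi i * b a j = - (b a j * psi i).
Hypothesis omd : forall c a j, om c * d a j = - (d a j * om c).
Hypothesis omb : forall c a j, om c * b a j = - (b a j * om c).
Hypothesis db : forall a i c j,
  d a i * b c j + b c j * d a i = if (a == c) && (i == j) then kap else 0.

Let PiC u i : comm u (P i) -> comm u (Pi i). Proof. exact: comm_inv. Qed.
Let XiC u a : comm u (X a) -> comm u (Xi a). Proof. exact: comm_inv. Qed.

Let antiC (u v : L) : u * v = - (v * u) -> v * u = - (u * v).
Proof. by move=> ->; rewrite opprK. Qed.

Let anti_mull (x y z : L) : comm z x -> y * z = - (z * y) -> x * y * z = - (z * (x * y)).
Proof. by move=> zx yz; rewrite -mulrA yz mulrN mulrA -zx -mulrA. Qed.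

Let dbE a i c j : d a i * b c j =
  (if (a == c) && (i == j) then kap else 0) - b c j * d a i.
Proof. by rewrite -db addrK. Qed.

Definition Uop a := \sum_j b a j * psi j.
(** For the full list these are the rows of the gl_n matrix paired with the [psi j]. The list holds
    the indices [a] whose [chiop a] has not been absorbed yet. *)
Definition phiop l i := P i * psi i + \sum_(a <- l) Xi a * Uop a * d a i.
Definition wop i := \sum_a b a i * om a.
Definition sop i := locked (Pi i * wop i).
Definition chiop a := X a * om a - \sum_i d a i * sop i.

Let sop_def i : sop i = Pi i * wop i. Proof. by rewrite /sop -lock. Qed.

Let U_comm u a : (forall j, comm u (b a j * psi j)) -> comm u (Uop a).
Proof. by move=> uC; apply: commr_sum => j _. Qed.
Let w_comm u i : (forall a, comm u (b a i * om a)) -> comm u (wop i).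
Proof. by move=> uC; apply: commr_sum => a _. Qed.

Let psiU i a : comm (psi i) (Uop a).
Proof. by apply: U_comm => j; apply: anti_anti_comm; [exact/antiC/psib|exact: psiN]. Qed.
Let bU c i a : comm (b c i) (Uop a).
Proof. by apply: U_comm => j; apply: anti_anti_comm; [exact: bN|exact: psib]. Qed.
Let XU c a : comm (X c) (Uop a).
Proof. by apply/commr_sym/commr_sym/U_comm => j; apply: commrM; apply: commr_sym. Qed.
Let PU i a : comm (P i) (Uop a).
Proof. by apply: U_comm => j; apply: commrM; apply: commr_sym. Qed.
Let UU a c : comm (Uop a) (Uop c).
Proof. by apply: U_comm => j; apply: commrM; apply: commr_sym; [exact: bU|exact: psiU]. Qed.
Let dU c i a : d c i * Uop a = Uop a * d c i + (if c == a then kap * psi i else 0).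
Proof.
have E j : d c i * (b a j * psi j) = b a j * psi j * d c i
    + (if (c == a) && (i == j) then kap * psi j else 0).
  rewrite mulrA dbE mulrBl -!mulrA psid mulrN addrC.
  by congr (_ + _); case: ifP => // _; rewrite mul0r.
rewrite mulr_sumr (eq_bigr _ (fun j _ => E j)) big_split -mulr_suml; congr (_ + _).
case: eqP => _ /=; last by rewrite big1.
by rewrite -big_mkcond /= (big_pred1 i) // => j; rewrite eq_sym.
Qed.

Let omw c i : comm (om c) (wop i).
Proof. by apply: w_comm => a; apply: anti_anti_comm; [exact/antiC/omb|exact: omN]. Qed.
Let bw c j i : comm (b c j) (wop i).
Proof. by apply: w_comm => a; apply: anti_anti_comm; [exact: bN|exact: omb]. Qed.
Let Xw c i : comm (X c) (wop i).
Proof. by apply: w_comm => a; apply: commrM; apply: commr_sym. Qed.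
Let Pw j i : comm (P j) (wop i).
Proof. by apply: w_comm => a; apply: commrM; apply: commr_sym. Qed.
Let ww i j : comm (wop i) (wop j).
Proof. by apply: w_comm => a; apply: commrM; apply: commr_sym; [exact: bw|exact: omw]. Qed.
Let dw c i j : d c i * wop j = wop j * d c i + (if i == j then kap * om c else 0).
Proof.
have E a : d c i * (b a j * om a) = b a j * om a * d c i
    + (if (i == j) && (c == a) then kap * om a else 0).
  rewrite mulrA dbE mulrBl -!mulrA omd mulrN addrC andbC.
  by congr (_ + _); case: ifP => // _; rewrite mul0r.
rewrite mulr_sumr (eq_bigr _ (fun a _ => E a)) big_split -mulr_suml; congr (_ + _).
case: eqP => _ /=; last by rewrite big1.
by rewrite -big_mkcond /= (big_pred1 c) // => a; rewrite eq_sym.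
Qed.

Let phiop_cons r l i : phiop (r :: l) i = phiop l i + Xi r * Uop r * d r i.
Proof. by rewrite /phiop big_cons addrA addrAC. Qed.

(** * Adjoining an index outside the list *)

Section Fresh.
Variables (l : seq 'I_k) (r : 'I_k).
Hypothesis rl : r \notin l.

Let phid i j : phiop l i * d r j = - (d r j * phiop l i).
Proof.
rewrite mulrDl mulrDr opprD anti_mull //; congr (_ + _).
rewrite big_seq mulr_suml mulr_sumr -sumrN; apply: eq_bigr => a al.
apply: anti_mull => //; apply: commrM; first by apply: XiC.
rewrite /comm dU ifN ?addr0 //; by apply: contraNneq rl => ->.
Qed.

Let phiX i : phiop l i * X r = X r * phiop l i + kap * psi i.
Proof.
rewrite mulrDl mulrDr -mulrA Xpsi mulrA PX mulrDl -mulrA addrAC; congr (_ + _ + _).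
apply/esym/commr_sum => a _; apply: commrM; last exact/commr_sym/Xd.
by apply: commrM; [apply: XiC|exact: XU].
Qed.

Let phiU i : phiop l i * Uop r = Uop r * phiop l i.
Proof.
apply/esym; rewrite /phiop big_seq; apply: commrD.
  by apply: commrM; apply: commr_sym.
apply: commr_sum => a al; apply: commrM; first apply: commrM.
- by apply/XiC/commr_sym.
- exact: UU.
by rewrite /comm dU ifN ?addr0 // eq_sym; apply: contraNneq rl => ->.
Qed.

Let kpsiX i : kap * psi i * X r = X r * (kap * psi i).
Proof. by rewrite -mulrA Xpsi !mulrA kapC. Qed.
Let kpsiU i : kap * psi i * Uop r = Uop r * (kap * psi i).
Proof. by rewrite -mulrA psiU !mulrA kapC. Qed.
Let drU i : d r i * Uop r = Uop r * d r i + kap * psi i.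
Proof. by rewrite dU eqxx. Qed.

(** The facts above are the hypotheses of the perturbation lemmas, with [kap * psi i] as the common
    commutator: it comes from [P i] and [X r] on one side, from [d r i] and [Uop r] on the other.
    Freshness of [r] keeps the older terms from contributing. *)
Lemma phiop_anti_cons :
  (forall i j, phiop l i * phiop l j = - (phiop l j * phiop l i)) ->
  forall i j, phiop (r :: l) i * phiop (r :: l) j = - (phiop (r :: l) j * phiop (r :: l) i).
Proof.
move=> phiN i j; rewrite !phiop_cons.
exact: (pert_anti phiN (fun i j => dN r i r j) phid phiX drU phiU
  (fun i => Xd r r i) (XK r) (XiK r) (XU r r) kpsiX kpsiU).
Qed.

Lemma prod_phiop_cons (g : 'I_n -> L) (w c : L) :
  (forall i j, phiop l i * phiop l j = - (phiop l j * phiop l i)) ->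
  c = X r * w - \sum_i d r i * g i ->
  \sum_i phiop l i * g i = - (Uop r * w) ->
  (\prod_i phiop (r :: l) i) * c = X r * (\prod_i phiop l i) * w.
Proof.
move=> phiN cE gE; under eq_bigr => i _ do rewrite phiop_cons.
apply: (prod_telescope phiN _ (fun i j => dN r i r j) _ phid phiX drU phiU
  (fun i => Xd r r i) (XK r) (XiK r) (XU r r) kpsiX kpsiU cE gE) => i; apply: tors.
  exact: phiN.
exact: dN.
Qed.
End Fresh.

Lemma phiop_anti l : uniq l ->
  forall i j, phiop l i * phiop l j = - (phiop l j * phiop l i).
Proof.
elim: l => [_ i j|r l IHl /andP[rl Ul]]; last exact: phiop_anti_cons (IHl Ul).
rewrite /phiop !big_nil !addr0.
have E u v : P u * psi u * (P v * psi v) = P u * P v * (psi u * psi v).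
  by rewrite -!mulrA; congr (_ * _); rewrite mulrA Ppsi -mulrA.
by rewrite !E PP psiN mulrN.
Qed.

Let sopE i u : comm u (P i) -> comm u (wop i) -> comm u (sop i).
Proof. by move=> uP uw; rewrite sop_def; apply: commrM => //; apply: PiC. Qed.

Let oms c i : comm (om c) (sop i). Proof. exact: sopE. Qed.
Let ss i j : comm (sop i) (sop j).
Proof.
by apply: sopE; apply: commr_sym; rewrite sop_def; apply: commrM => //; apply: PiC => //; exact: commr_sym.
Qed.
Let ds a i j : d a i * sop j =
  sop j * d a i + (if i == j then kap * (Pi j * om a) else 0).
Proof.
have dPi : d a i * Pi j = Pi j * d a i by apply: PiC.
rewrite !sop_def mulrA dPi -!mulrA dw mulrDr; congr (_ + _).
by case: ifP => _; rewrite ?mulr0 // !mulrA kapC.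
Qed.
Let XPi a i : X a * Pi i = Pi i * X a + kap * (Pi i * Pi i).
Proof.
rewrite -[LHS]mul1r -(PiK i) -mulrA (mulrA (P i)) PX mulrDl mulrDr -(mulrA (X a)) PK mulr1.
by rewrite [X in _ + X]mulrA kapC -mulrA.
Qed.
Let Xs a i : X a * sop i = sop i * X a + kap * (Pi i * sop i).
Proof.
rewrite !sop_def mulrA XPi mulrDl -!mulrA Xw; congr (_ + _).
Qed.

(** Moving [X a] past [Pi i] and [d a i] past [wop i] produce the same correction
    [kap * (Pi i * (sop i * om a))], and [chiop a] contains the difference of the two. *)
Let chis a i : comm (chiop a) (sop i).
Proof.
have E : (\sum_j d a j * sop j) * sop i =
    sop i * (\sum_j d a j * sop j) + kap * (Pi i * (sop i * om a)).
  rewrite mulr_suml mulr_sumr.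
  have F j : d a j * sop j * sop i = sop i * (d a j * sop j) +
      (if j == i then kap * (Pi i * (sop i * om a)) else 0).
    rewrite -mulrA (ss j i) mulrA (ds a j i) mulrDl -mulrA; congr (_ + _).
    by case: eqP => [->|_]; rewrite ?mul0r // -!mulrA (oms a i).
  rewrite (eq_bigr _ (fun j _ => F j)) big_split -big_mkcond /=.
  by rewrite big_pred1_eq.
rewrite /comm mulrBl mulrBr E -mulrA oms mulrA Xs mulrDl -!mulrA; abel.
Qed.

Lemma chiop_anti a c : chiop a * chiop c = - (chiop c * chiop a).
Proof.
(* Since [chiop v] commutes with each [sop i], the product takes a form in which exchanging [u] and
   [v] reverses the sign of each of the three parts. *)
have E u v : chiop u * chiop v = X u * X v * (om u * om v)
    + \sum_i (X v * om v * d u i - X u * om u * d v i) * sop i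
    + \sum_i \sum_j d u i * d v j * (sop i * sop j).
  rewrite [in LHS]/chiop mulrBl mulr_suml -/(chiop v).
  have F i : d u i * sop i * chiop v = - (X v * om v * d u i * sop i)
      - \sum_j d u i * d v j * (sop i * sop j).
    rewrite -mulrA -chis mulrA /chiop mulrBr mulrBl; congr (_ - _).
      by rewrite mulrA Xd -[X v * d u i * om v]mulrA -[d u i * om v]opprK -omd mulrN mulNr mulrA.
    rewrite mulr_sumr mulr_suml; apply: eq_bigr => j _.
    by rewrite -!mulrA (ss j i).
  rewrite (eq_bigr _ (fun i _ => F i)) big_split /= !sumrN.
  rewrite /chiop mulrBr mulr_sumr (eq_bigr _ (fun i _ => mulrA _ _ _)).
  rewrite [X in _ = _ + X + _](eq_bigr (fun i => X v * om v * d u i * sop i - X u * om u * d v i * sop i)); last first.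
    by move=> i _; rewrite mulrBl.
  rewrite big_split /= sumrN.
  have -> : X u * om u * (X v * om v) = X u * X v * (om u * om v).
    by rewrite -!mulrA; congr (_ * _); rewrite mulrA Xom -mulrA.
  abel.
rewrite !E XX (omN a c) mulrN !opprD; congr (_ + _ + _).
  by rewrite -sumrN; apply: eq_bigr => i _; rewrite -[RHS]mulNr opprB.
rewrite exchange_big -sumrN; apply: eq_bigr => i _; rewrite -sumrN.
by apply: eq_bigr => j _; rewrite dN ss mulNr.
Qed.

Let om_chi c a : chiop a * om c = - (om c * chiop a).
Proof.
rewrite /chiop mulrBl mulrBr opprB addrC; congr (_ + _); last first.
  by rewrite mulrA Xom -!mulrA omN mulrN.
rewrite mulr_suml mulr_sumr -sumrN; apply: eq_bigr => i _.
by rewrite -mulrA -oms !mulrA omd mulNr.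
Qed.

(** [P i] cancels against [Pi i], and the sum of the [d a i * sop i] is [X a * om a - chiop a].
    Multiplied by the product of the [chiop a] over [l], the terms with [chiop a] vanish and the
    rest cancels for [a] in [l]. *)
Let phi_sop l : \sum_i phiop l i * sop i =
  - (\sum_a Uop a * om a) + \sum_(a <- l) (Uop a * om a - Xi a * Uop a * chiop a).
Proof.
rewrite /phiop; under eq_bigr => i _ do rewrite mulrDl mulr_suml.
rewrite big_split exchange_big /=; congr (_ + _).
  have E i : P i * psi i * sop i = - \sum_a b a i * psi i * om a.
    rewrite -Ppsi sop_def -mulrA [P i * _]mulrA PK mul1r /wop mulr_sumr -sumrN.
    by apply: eq_bigr => a _; rewrite mulrA psib mulNr.
  rewrite (eq_bigr _ (fun i _ => E i)) sumrN exchange_big; congr (- _).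
  by apply: eq_bigr => a _; rewrite mulr_suml.
apply: eq_bigr => a _.
under eq_bigr => i _ do rewrite -(mulrA (Xi a * Uop a)).
rewrite -mulr_sumr; have -> : \sum_i d a i * sop i = X a * om a - chiop a.
  by rewrite opprB addrC subrK.
by rewrite mulrBr [Xi a * _ * (X a * _)]mulrA -[Xi a * _ * X a]mulrA -XU mulrA XiK mul1r.
Qed.

(** [tau] accumulates the [om] already split off: absorbing [chiop r] replaces it by [om r * tau].
    The condition on [tau] kills the terms [Uop a * om a] with [a] outside the list; for the full
    list, where the lemma is applied, it is vacuous. *)
Lemma prod_phiop_chiop l tau : uniq l -> (forall a, a \notin l -> om a * tau = 0) ->
  (\prod_i phiop l i) * ((\prod_(a <- l) chiop a) * tau) =
  (\prod_(a <- l) X a) * ((\prod_i (P i * psi i)) * ((\prod_(a <- l) om a) * tau)).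
Proof.
elim: l tau => [|r l IHl] tau; first by rewrite /phiop !big_nil !mul1r; under eq_bigr do rewrite big_nil addr0.
move=> /= /andP[rl Ul] tau0.
pose Om := (\prod_(a <- l) chiop a) * tau.
have om2 a : om a * om a = 0 by apply: tors; apply: omN.
have chi0 a : a \in l -> chiop a * Om = 0.
  move=> al; rewrite /Om mulrA (prod_anti_mem chiop_anti) ?mul0r // => c.
  by apply: tors; apply: chiop_anti.
have om_prod c (u : L) : om c * ((\prod_(a <- l) chiop a) * u) =
    (-1) ^+ size l * ((\prod_(a <- l) chiop a) * (om c * u)).
  have := prod_anti_move (a := om c) l (om_chi c).
  move=> /(congr1 (fun v => (-1) ^+ size l * (v * u))).
  by rewrite !mulrA -signr_odd -expr2 sqrr_sign mul1r => ->.
have om_prod' (u : L) : om r * ((\prod_(a <- l) om a) * u) =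
    (-1) ^+ size l * ((\prod_(a <- l) om a) * (om r * u)).
  have := prod_anti_move (a := om r) l (fun a => omN a r).
  move=> /(congr1 (fun v => (-1) ^+ size l * (v * u))).
  by rewrite !mulrA -signr_odd -expr2 sqrr_sign mul1r => ->.
rewrite !big_cons -[chiop r * _ * tau]mulrA -/Om.
rewrite (@prod_phiop_cons _ _ rl (fun i => sop i * Om) (om r * Om)).
- rewrite om_prod -!(mulrA (X r)); congr (_ * _).
  have C (u v : L) : u * ((-1) ^+ size l * v) = (-1) ^+ size l * (u * v).
    by rewrite mulrA (commr_sign u (size l) : _ * _ = _) -mulrA.
  rewrite C IHl // => [|a al].
    by rewrite -(mulrA (om r)) om_prod' !C.
  have [->|ar] := eqVneq a r; first by rewrite mulrA om2 mul0r.
  by rewrite mulrA omN mulNr -mulrA tau0 ?mulr0 ?oppr0 // inE negb_or ar.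
- exact: phiop_anti.
- rewrite mulrBl -!mulrA; congr (_ - _); rewrite mulr_suml.
  by apply: eq_bigr => i _; rewrite mulrA.
under eq_bigr => i _ do rewrite mulrA.
rewrite -mulr_suml phi_sop mulrDl mulNr [X in _ + X]mulr_suml.
have -> : (\sum_a Uop a * om a) * Om = \sum_(a <- r :: l) Uop a * om a * Om.
  rewrite mulr_suml (bigID (mem (r :: l))) /= [X in _ + X]big1 ?addr0.
    by rewrite -big_uniq //= rl.
  by move=> a al; rewrite -mulrA om_prod tau0 // !mulr0.
rewrite big_cons opprD -addrA mulrA -[RHS]addr0; congr (_ + _).
rewrite addrC -sumrB big_seq big1 // => a al.
by rewrite mulrBl -[Xi a * _ * _ * Om]mulrA chi0 // mulr0 subr0 addrN.
Qed.

Definition mat_n i j : L := (if i == j then P i else 0) - \sum_a Xi a * (b a j * d a i).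
Definition mat_k a c : L := (if a == c then X a else 0) + \sum_i Pi i * (b c i * d a i).

Let bd_comm u a i c j : u * b a i = - (b a i * u) -> u * d c j = - (d c j * u) ->
  comm u (b a i * d c j).
Proof. by move=> ub ud; apply: anti_anti_comm; exact: antiC. Qed.

Let prod_phi : \prod_i phiop (index_enum 'I_k) i = rdet mat_n * \prod_i psi i.
Proof.
rewrite -(prod_rdet psiN) => [|i|i j m]; first 2 last.
- rewrite -/(comm _ _); apply/commr_sym; apply: commrB.
    by case: eqP => // _; apply: commr0.
  apply: commr_sum => a _; apply: commrM; first by apply: XiC.
  by apply: bd_comm => //; apply: psid.
- apply: eq_bigr => i _; rewrite (eq_bigr _ (fun j _ => mulrBl _ _ _)) sumrB.
  rewrite (bigD1 i) //= eqxx big1 ?addr0 => [|j ji]; last first.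
    by rewrite eq_sym (negPf ji) mul0r.
  rewrite /phiop; congr (_ + _); under [X in - X]eq_bigr do rewrite mulr_suml.
  rewrite exchange_big -sumrN; apply: eq_bigr => a _.
  rewrite /Uop mulr_sumr mulr_suml -sumrN; apply: eq_bigr => j _.
  by rewrite -!mulrA psid !mulrN.
by apply: tors; apply: psiN.
Qed.

Variable Pbi : L.
Hypotheses (PbK : (\prod_i P i) * Pbi = 1) (PbiK : Pbi * (\prod_i P i) = 1).

Let PbiC u : (forall i, comm u (P i)) -> comm u Pbi.
Proof. by move=> uP; apply: (comm_inv PbiK PbK); apply: commr_prod => i _. Qed.

Let chin a := \sum_c mat_k a c * om c.

(** The matrix has [b] to the left of [d], [chiop] has it to the right. Reordering [b a i * d a i]
    costs one [kap], whence the terms [kap * Pi i] added to [X a]. *)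
Let chinE a : chin a = (X a + \sum_i kap * Pi i) * om a - \sum_i d a i * sop i.
Proof.
rewrite /chin (eq_bigr _ (fun c _ => mulrDl _ _ _)) big_split /= mulrDl -addrA.
congr (_ + _).
  rewrite (bigD1 a) //= eqxx big1 ?addr0 // => c ca.
  by rewrite eq_sym (negPf ca) mul0r.
rewrite (eq_bigr _ (fun c _ => mulr_suml _ _ _ _)) exchange_big mulr_suml -sumrB.
apply: eq_bigr => i _.
have dPi : d a i * Pi i = Pi i * d a i by apply: PiC.
rewrite sop_def mulrA dPi -mulrA.
have -> : \sum_c Pi i * (b c i * d a i) * om c =
    Pi i * \sum_c ((if a == c then kap * om c else 0) - d a i * (b c i * om c)).
  rewrite mulr_sumr; apply: eq_bigr => c _; rewrite -mulrA; congr (_ * _).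
  have := dbE a i c i; rewrite eqxx andbT => E.
  by rewrite [d a i * (_ * _)]mulrA E mulrBl; case: ifP => _; rewrite ?mul0r; abel.
rewrite sumrB -big_mkcond (big_pred1 a) => [|c]; last exact: eq_sym.
by rewrite mulrBr -mulr_sumr !mulrA kapC.
Qed.

(** Each [P i] moved past [X a] adds one [kap * Pi i], so conjugation by the product of the [P i]
    produces exactly the shift in [chinE]; the rest of [chiop a] commutes with the [P i]. *)
Let chiop_conj a : chiop a * Pbi = Pbi * chin a.
Proof.
pose Pb0 := \prod_i P i.
have PX' : Pb0 * X a = (X a + \sum_i kap * Pi i) * Pb0.
  rewrite /Pb0; elim: (index_enum _) => [|i s IHs].
    by rewrite !big_nil addr0 mulr1 mul1r.
  rewrite !big_cons -mulrA IHs [RHS]mulrA [LHS]mulrA; congr (_ * _).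
  have S : comm (P i) (\sum_(j <- s) kap * Pi j).
    by apply: commr_sum => j _; apply: commrM; [exact: kapC|apply: PiC].
  by rewrite mulrDr S PX !mulrDl -(mulrA kap) PiK mulr1 addrA.
have E : Pb0 * chiop a = chin a * Pb0.
  have PbC u : (forall i, comm u (P i)) -> comm u Pb0.
    by move=> uP; apply: commr_prod => i _.
  rewrite chinE /chiop mulrBr mulrBl mulrA PX' -!mulrA PbC //; congr (_ - _).
  rewrite mulr_suml mulr_sumr; apply: eq_bigr => i _; apply/esym/PbC => j.
  apply/commr_sym/commrM; first exact: commr_sym.
  by apply: sopE => //; apply/PP.
rewrite -[LHS]mul1r -PbiK -!mulrA; congr (_ * _).
by rewrite mulrA E -mulrA PbK mulr1.
Qed.

Theorem rdet_mat_n_mat_k :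
  rdet mat_n * Pbi * rdet mat_k * ((\prod_i psi i) * \prod_a om a) =
  (\prod_a X a) * ((\prod_i psi i) * \prod_a om a).
Proof.
(* With [tau = Pbi], the left side conjugates every [chiop a] into [chin a], and on the right [Pbi]
   cancels the product of the [P i] that accompanies the [psi i]. *)
have := @prod_phiop_chiop (index_enum 'I_k) Pbi (index_enum_uniq _).
rewrite prod_phi => /(_ _)/wrap[a|]; first by rewrite mem_index_enum.
have chiPbi s : (\prod_(a <- s) chiop a) * Pbi = Pbi * \prod_(a <- s) chin a.
  elim: s => [|a s IHs]; first by rewrite !big_nil mulr1 mul1r.
  by rewrite !big_cons -mulrA IHs mulrA chiop_conj mulrA.
have psiPbi : comm Pbi (\prod_i psi i).
  by apply: commr_prod => i _; apply/commr_sym/PbiC.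
have omPbi : (\prod_i P i) * ((\prod_i psi i) * ((\prod_a om a) * Pbi)) =
    (\prod_i psi i) * \prod_a om a.
  have omC : comm Pbi (\prod_a om a).
    by apply: commr_prod => a _; apply/commr_sym/PbiC.
  rewrite -omC [(\prod_i psi i) * _]mulrA -psiPbi !mulrA PbK.
  by rewrite mul1r.
have Ppsi_prod s : \prod_(i <- s) (P i * psi i) =
    (\prod_(i <- s) P i) * \prod_(i <- s) psi i.
  elim: s => [|i s IHs]; first by rewrite !big_nil mulr1.
  rewrite !big_cons IHs -!mulrA; congr (_ * _); rewrite !mulrA; congr (_ * _).
  by apply: commr_prod => j _; apply: Ppsi.
have psiN_k i a c : comm (psi i) (mat_k a c).
  apply: commrD; first by case: eqP => // _; apply: commr0.
  apply: commr_sum => j _; apply: commrM; first by apply: PiC.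
  exact: bd_comm.
have psi_rdet : comm (\prod_i psi i) (rdet mat_k).
  apply: commr_sum => s _; apply: commrM; first exact: commr_sign.
  apply: commr_prod => a _; apply/commr_sym/commr_prod => i _.
  exact/commr_sym/psiN_k.
have chin_prod : \prod_a chin a = rdet mat_k * \prod_a om a.
  apply: prod_rdet => [a c|a|a c e]; first exact: omN.
    by apply: tors; apply: omN.
  apply/esym/commrD; first by case: eqP => // _; apply: commr0.
  apply: commr_sum => j _; apply: commrM; first by apply: PiC.
  exact: bd_comm.
rewrite chiPbi chin_prod Ppsi_prod -(mulrA (\prod_i P i)) omPbi => <-.
rewrite -!mulrA; congr (_ * _); rewrite [RHS]mulrA -psiPbi -mulrA; congr (_ * _).
by rewrite [RHS]mulrA psi_rdet -mulrA.
Qed.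
End NormalOrdering.

(** The [ys i] behave like derivations dual to the [y i]. Insert [ys i * y i + y i * ys i = 1] after
    [A]: moving [ys i] left past [A] in one term and right past the remaining [y j] in the other
    exposes the vanishing product in both. *)
Lemma cancel_prod_anti (L : pzRingType) (I : eqType) (y ys : I -> L) (s : seq I) (A : L) :
  uniq s -> (forall i, ys i * y i + y i * ys i = 1) ->
  (forall i j, i != j -> y j * ys i = - (ys i * y j)) ->
  (forall i, GRing.comm (ys i) A) ->
  A * \prod_(i <- s) y i = 0 -> A = 0.
Proof.
move=> Us yy yN ysA; elim: s Us => [_|i s IHs /= /andP[is_ Us]].
  by rewrite big_nil mulr1.
rewrite big_cons => Ay; apply: IHs => //.
have W t : i \notin t ->
    (\prod_(j <- t) y j) * ys i = (-1) ^+ size t * (ys i * \prod_(j <- t) y j).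
  elim: t => [|j t IHt]; first by rewrite !big_nil !mul1r mulr1.
  rewrite inE negb_or => /andP[ij it].
  by rewrite !big_cons -mulrA IHt // mulr_anti_sign // yN.
have W' : ys i * \prod_(j <- s) y j = (-1) ^+ size s * ((\prod_(j <- s) y j) * ys i).
  by rewrite W // [RHS]mulrA -signr_odd -expr2 sqrr_sign mul1r.
set V := \prod_(j <- s) y j in Ay W' *.
have -> : A * V = A * (ys i * y i * V) + A * (y i * ys i * V).
  by rewrite -mulrDr -mulrDl yy mul1r.
have -> : A * (ys i * y i * V) = ys i * (A * (y i * V)).
  by rewrite !mulrA ysA.
have C (u v : L) : u * ((-1) ^+ size s * v) = (-1) ^+ size s * (u * v).
  by rewrite mulrA (commr_sign u (size s) : _ * _ = _) -mulrA.
by rewrite Ay mulr0 add0r -mulrA W' !C [y i * _]mulrA [A * _]mulrA Ay mul0r mulr0.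
Qed.

(** * The Clifford algebra of the Grassmann variables *)

Section Fermions.
Variables k n : nat.
Local Notation dbl := ('I_k * 'I_n)%type.
Local Notation gdim := #|{set dbl}|.
Implicit Types (c e : dbl) (S T : {set dbl}) (A : 'M[C]_gdim).

Lemma nbeforeU S c e : e \notin S -> nbefore (e |: S) c = (nbefore S c + (rk e < rk c))%N.
Proof.
move=> eS; rewrite /nbefore; case: ltnP => ec; last first.
  rewrite addn0; apply: eq_card => x; rewrite !inE.
  by case: eqVneq => [->|//]; rewrite ltnNge ec (negPf eS).
rewrite addn1 -[RHS]/(1 + _)%N.
have -> : [set s in e |: S | (rk s < rk c)%N] = e |: [set s in S | (rk s < rk c)%N].
  by apply/setP => x; rewrite !inE; case: eqVneq => [->|//]; rewrite ec.
by rewrite cardsU1 !inE (negPf eS).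
Qed.

Lemma nbeforeD S c e : e \in S -> nbefore S c = (nbefore (S :\ e) c + (rk e < rk c))%N.
Proof. by move=> eS; rewrite -nbeforeU ?setD1K // !inE eqxx. Qed.

Lemma rk_lt c e : c != e -> (rk c < rk e)%N = ~~ (rk e < rk c)%N.
Proof.
move=> ce; rewrite -leqNgt ltn_neqAle; apply: andb_idl => _.
by apply: contraNneq ce => /val_inj/enum_rank_inj->.
Qed.

Lemma xi_opE c p q : xi_op c p q =
  if (c \notin enum_val q) && (enum_val p == c |: enum_val q)
  then (-1) ^+ nbefore (enum_val q) c else 0.
Proof. by rewrite mxE. Qed.

Lemma del_opE c p q : del_op c p q =
  if (c \in enum_val q) && (enum_val p == enum_val q :\ c)
  then (-1) ^+ nbefore (enum_val q) c else 0.
Proof. by rewrite mxE. Qed.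

Lemma mul_xi A e p q : (A *m xi_op e) p q =
  if e \notin enum_val q then
    A p (enum_rank (e |: enum_val q)) * (-1) ^+ nbefore (enum_val q) e
  else 0.
Proof.
rewrite mxE; case: ifP => eS; last first.
  by rewrite big1 // => r _; rewrite xi_opE eS mulr0.
rewrite (bigD1 (enum_rank (e |: enum_val q))) //= big1 ?addr0 => [|r re].
  by rewrite xi_opE eS enum_rankK eqxx.
rewrite xi_opE eS ifN ?mulr0 //; apply: contraNneq re => <-.
by rewrite enum_valK.
Qed.

Lemma mul_del A e p q : (A *m del_op e) p q =
  if e \in enum_val q then
    A p (enum_rank (enum_val q :\ e)) * (-1) ^+ nbefore (enum_val q) e
  else 0.
Proof.
rewrite mxE; case: ifP => eS; last first.
  by rewrite big1 // => r _; rewrite del_opE eS mulr0.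
rewrite (bigD1 (enum_rank (enum_val q :\ e))) //= big1 ?addr0 => [|r re].
  by rewrite del_opE eS enum_rankK eqxx.
rewrite del_opE eS ifN ?mulr0 //; apply: contraNneq re => <-.
by rewrite enum_valK.
Qed.

Lemma xi_anti c e : xi_op c *m xi_op e = - (xi_op e *m xi_op c).
Proof.
apply/matrixP => p q; rewrite [RHS]mxE !mul_xi !xi_opE !enum_rankK.
set S := enum_val q; have [->|ce] := eqVneq c e.
  by rewrite !inE eqxx /= mul0r; case: ifP; rewrite oppr0.
rewrite !inE (eq_sym e) (negPf ce) /=.
case: (boolP (c \in S)) => cS; case: (boolP (e \in S)) => eS /=; rewrite ?mul0r ?oppr0 //.
rewrite setUCA; case: eqP => _; rewrite ?mul0r ?oppr0 //.
(* Exactly one of the two variables precedes the other, so exactly one of the two orders picks up an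
   extra sign. *)
rewrite !nbeforeU // -!exprD (rk_lt ce); case: (rk e < rk c)%N => /=.
  by rewrite addn0 addn1 addSn exprS mulN1r addnC.
by rewrite addn0 addn1 addSn exprS mulN1r opprK addnC.
Qed.

Lemma del_anti c e : del_op c *m del_op e = - (del_op e *m del_op c).
Proof.
apply/matrixP => p q; rewrite [RHS]mxE !mul_del !del_opE !enum_rankK.
set S := enum_val q; have [->|ce] := eqVneq c e.
  by rewrite !inE eqxx /= mul0r; case: ifP; rewrite oppr0.
rewrite !inE (eq_sym e) ce /=.
case: (boolP (c \in S)) => cS; case: (boolP (e \in S)) => eS /=; rewrite ?mul0r ?oppr0 //.
have -> : S :\ e :\ c = S :\ c :\ e by rewrite !setDDl setUC.
case: eqP => _; rewrite ?mul0r ?oppr0 //.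
rewrite (nbeforeD e cS) (nbeforeD c eS) -!exprD (rk_lt ce); case: (rk e < rk c)%N => /=.
  by rewrite addn0 addn1 addnS exprS mulN1r opprK addnC.
by rewrite addn0 addn1 addnS exprS mulN1r addnC.
Qed.

Lemma del_xi c e :
  del_op c *m xi_op e + xi_op e *m del_op c = (if c == e then 1 else 0)%:M.
Proof.
apply/matrixP => p q; rewrite [LHS]mxE mul_xi mul_del xi_opE del_opE !enum_rankK [RHS]mxE.
rewrite -(inj_eq enum_val_inj) !inE; set S := enum_val q; set S' := enum_val p.
have sq (m : nat) : (-1) ^+ m * (-1) ^+ m = 1 :> C by rewrite -exprD addnn -signr_odd odd_double.
have [->|ce] := eqVneq c e.
  case: (boolP (e \in S)) => eS /=.
    by rewrite setD1K // add0r (nbeforeD e eS) ltnn addn0; case: eqP; rewrite ?sq ?mul0r.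
  by rewrite setU1K // addr0 nbeforeU // ltnn addn0; case: eqP; rewrite ?sq ?mul0r.
rewrite mul0rn /=.
case: (boolP (c \in S)) => cS; case: (boolP (e \in S)) => eS /=; rewrite ?mul0r ?addr0 //.
have -> : (e |: S) :\ c = e |: (S :\ c).
  by apply/setP => x; rewrite !inE; case: (eqVneq x e) => // ->; rewrite eq_sym ce.
case: eqP => _; rewrite ?mul0r ?addr0 //.
rewrite nbeforeU // (nbeforeD e cS) -!exprD (rk_lt ce); case: (rk e < rk c)%N => /=.
  by rewrite addn0 addn1 addSn exprS mulN1r addnC addNr.
by rewrite addn0 addn1 addnS exprS mulN1r addnC addNr.
Qed.

Definition parity : 'M[C]_gdim :=
  \matrix_(p < gdim, q < gdim)
    (if p == q then (-1) ^+ #|(enum_val p : {set dbl})| else 0).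

Lemma mul_parity A p q : (A *m parity) p q = A p q * (-1) ^+ #|(enum_val q : {set dbl})|.
Proof.
rewrite mxE (bigD1 q) //= big1 ?addr0 => [|r re]; rewrite mxE ?eqxx //.
by rewrite (negPf re) mulr0.
Qed.

Lemma parity_mul A p q : (parity *m A) p q = (-1) ^+ #|(enum_val p : {set dbl})| * A p q.
Proof.
rewrite mxE (bigD1 p) //= big1 ?addr0 => [|r re]; rewrite mxE ?eqxx //.
by rewrite eq_sym (negPf re) mul0r.
Qed.

Lemma parity_sq : parity *m parity = 1%:M.
Proof.
apply/matrixP => p q; rewrite mul_parity !mxE; case: eqP => [->|_]; last by rewrite mul0r.
by rewrite -exprD addnn -signr_odd odd_double.
Qed.

Lemma parity_xi c : parity *m xi_op c = - (xi_op c *m parity).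
Proof.
apply/matrixP => p q; rewrite [RHS]mxE mul_parity parity_mul xi_opE.
case: ifP => [/andP[cS /eqP->]|_]; last by rewrite mulr0 mul0r oppr0.
by rewrite cardsU1 cS exprS mulN1r mulNr mulrC.
Qed.

Lemma parity_del c : parity *m del_op c = - (del_op c *m parity).
Proof.
apply/matrixP => p q; rewrite [RHS]mxE mul_parity parity_mul del_opE.
case: ifP => [/andP[cS /eqP->]|_]; last by rewrite mulr0 mul0r oppr0.
by rewrite [in RHS](cardsD1 c) cS exprS mulN1r mulrN opprK mulrC.
Qed.
End Fermions.

Lemma rmorph_rdet (A B : pzRingType) (f : {rmorphism A -> B}) m (M : 'I_m -> 'I_m -> A) :
  f (rdet M) = rdet (fun i j => f (M i j)).
Proof.
rewrite rmorph_sum; apply: eq_bigr => s _.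
by rewrite rmorphM rmorph_sign rmorph_prod.
Qed.

Lemma eq_rdet (A : pzRingType) m (M N : 'I_m -> 'I_m -> A) :
  (forall i j, M i j = N i j) -> rdet M = rdet N.
Proof.
move=> MN; apply: eq_bigr => s _; congr (_ * _).
by apply: eq_bigr => i _.
Qed.

Lemma scalar_mx_comm (E : pzRingType) m (u : E) (M : 'M[E]_m) :
  (forall i j, GRing.comm u (M i j)) -> GRing.comm (u%:M : 'M[E]_m) M.
Proof.
move=> uM; apply/matrixP => i j; rewrite !mxE.
rewrite (bigD1 i) //= big1 ?addr0 => [|l li]; last first.
  by rewrite mxE eq_sym (negPf li) mul0r.
rewrite (bigD1 j) //= big1 ?addr0 => [|l lj]; last first.
  by rewrite [in X in _ * X]mxE (negPf lj) mulr0.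
by rewrite !mxE !eqxx; apply: uM.
Qed.

(** * The determinant identity for the Grassmann operators *)

Section FermionicDuality.
Variables (k n : nat) (E : pzRingType) (iota : {rmorphism EndP k n -> E}).
Variables (h : E) (P Pi : 'I_n -> E) (X Xi : 'I_k -> E) (Pbi : E).
Local Notation comm := GRing.comm.
Hypothesis hC : forall u, comm u h.
Hypotheses (PK : forall i, P i * Pi i = 1) (PiK : forall i, Pi i * P i = 1).
Hypotheses (XK : forall a, X a * Xi a = 1) (XiK : forall a, Xi a * X a = 1).
Hypotheses (PbK : (\prod_i P i) * Pbi = 1) (PbiK : Pbi * (\prod_i P i) = 1).
Hypotheses (PP : forall i j, comm (P i) (P j)) (XX : forall a c, comm (X a) (X c)).
Hypothesis PX : forall i a, P i * X a = X a * P i + h * h.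
Hypotheses (iotaP : forall A i, comm (iota A) (P i)).
Hypotheses (iotaX : forall A a, comm (iota A) (X a)).

(* The determinants are computed over matrices with entries in [E], where the
   Grassmann generators [psi], [om] adjoined to [E] live; the factor [parity]
   makes them anticommute with the variables of the original algebra. *)
Local Notation N := #|{set ('I_1 * 'I_(n + k))}|.
Local Notation L := 'M[E]_N.
Let emb (u : E) : L := u%:M.
Let embM u v : emb u * emb v = emb (u * v). Proof. exact/esym/scalar_mxM. Qed.
Let embN u : emb (- u) = - emb u. Proof. exact: raddfN. Qed.
Let embD u v : emb (u + v) = emb u + emb v. Proof. exact: raddfD. Qed.
Let embB u v : emb (u - v) = emb u - emb v. Proof. exact: raddfB. Qed.
Let emb0 : emb 0 = 0. Proof. exact: raddf0. Qed.
Let emb_sum (I : Type) (s : seq I) (F : I -> E) :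
  emb (\sum_(x <- s) F x) = \sum_(x <- s) emb (F x).
Proof. exact: raddf_sum. Qed.
Let emb_prod (I : Type) (s : seq I) (F : I -> E) :
  emb (\prod_(x <- s) F x) = \prod_(x <- s) emb (F x).
Proof. exact: (rmorph_prod (@scalar_mx E N)). Qed.
Let emb_rdet m (M : 'I_m -> 'I_m -> E) : emb (rdet M) = rdet (fun i j => emb (M i j)).
Proof. exact: (rmorph_rdet (@scalar_mx E N)). Qed.
Let emb_comm u v : comm u v -> comm (emb u) (emb v).
Proof. by move=> uv; rewrite /comm !embM uv. Qed.
Let sc : {rmorphism C -> E} := iota \o @scalar_mx _ _.
Let lift (M : 'M[C]_N) : L := map_mx sc M.
Let liftM A B : lift A * lift B = lift (A *m B). Proof. exact/esym/map_mxM. Qed.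
Let liftN A : lift (- A) = - lift A. Proof. exact: map_mxN. Qed.
Let emb_lift u M : (forall c, comm u (sc c)) -> comm (emb u) (lift M).
Proof. by move=> uc; apply: scalar_mx_comm => i j; rewrite mxE. Qed.
Let eps := emb (iota (parity k n)).
Let scC A c : comm (iota A) (sc c).
Proof. by rewrite /comm /= -!rmorphM; congr (iota _); apply: scalar_mxC. Qed.
Let eps_lift M : comm eps (lift M). Proof. by apply: emb_lift => c; apply: scC. Qed.
Let eps2 : eps * eps = 1.
Proof. by rewrite embM -rmorphM [_ * _]parity_sq rmorph1. Qed.

(** The adjoined variables are those of a Grassmann algebra with one row and [n + k] columns, so the
    relations of [xi_op] and [del_op] serve a second time; [inl i] stands for [psi i], [inr a] for
    [om a]. *)
Let ix (x : 'I_n + 'I_k) : 'I_1 * 'I_(n + k) := (ord0, unsplit x).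
Let gen x := eps * lift (xi_op (ix x)).
Let ann x := eps * lift (del_op (ix x)).

Let ix_eq x y : (ix x == ix y) = (x == y).
Proof. by rewrite xpair_eqE eqxx /=; apply/inj_eq/(can_inj unsplitK). Qed.

Let genM A B : eps * lift A * (eps * lift B) = lift (A *m B).
Proof.
rewrite -mulrA [lift A * _]mulrA -eps_lift -!mulrA [eps * (eps * _)]mulrA eps2.
by rewrite mul1r liftM.
Qed.

Let genN x y : gen x * gen y = - (gen y * gen x).
Proof. by rewrite !genM xi_anti liftN. Qed.

Let ann_gen x y : ann x * gen y + gen y * ann x = (if x == y then 1 else 0).
Proof.
rewrite !genM -[lift _ + _]raddfD del_xi ix_eq.
by rewrite /= map_scalar_mx; case: eqP => _; rewrite ?rmorph1 ?rmorph0 ?raddf0.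
Qed.

Let emb_gen u x : (forall A, comm (iota A) u) -> comm (gen x) (emb u).
Proof.
move=> uA; apply/commr_sym/commrM; first exact/emb_comm/commr_sym.
by apply: emb_lift => c; apply/commr_sym/uA.
Qed.
Let gen_odd x A : parity k n *m A = - (A *m parity k n) ->
  gen x * emb (h * iota A) = - (emb (h * iota A) * gen x).
Proof.
move=> pA; rewrite -mulrA [in RHS]mulrA.
have E1 : lift (xi_op (ix x)) * emb (h * iota A) = emb (h * iota A) * lift (xi_op (ix x)).
  by apply/esym/emb_lift => c; apply/commr_sym/commrM; [exact: hC|apply/commr_sym/scC].
have E2 : eps * emb (h * iota A) = - (emb (h * iota A) * eps).
  rewrite !embM mulrA hC -!mulrA -!rmorphM [_ * A]pA rmorphN mulrN.
  by rewrite embN.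
have -> : eps * (lift (xi_op (ix x)) * emb (h * iota A)) =
    eps * emb (h * iota A) * lift (xi_op (ix x)) by rewrite E1 mulrA.
by rewrite E2 mulNr -!mulrA.
Qed.

(** One factor [h] each makes the anticommutator of [de a i] and [xi a i] equal to [h * h], the same
    central element as [P i * X a - X a * P i]; a single [kap] has to serve for both. *)
Let xi a i := emb (h * iota (xi_op (a, i))).
Let de a i := emb (h * iota (del_op (a, i))).
Let kap : L := emb (h * h).

Let hiotaM A B : emb (h * iota A) * emb (h * iota B) = emb (h * h * iota (A *m B)).
Proof. by rewrite embM -mulrA [iota A * _]mulrA hC -!mulrA -rmorphM. Qed.

(** [E] contains one half, as the image of a scalar matrix. *)
Let torsE (x : E) : x = - x -> x = 0.
Proof.
move=> xN; have x2 : x + x = 0 by rewrite {2}xN addrN.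
have half : 2^-1 + 2^-1 = 1 :> C.
  by rewrite -mulr2n -[LHS]mulr_natr mulVf // Num.Theory.pnatr_eq0.
have: sc 2^-1 * (x + x) = x by rewrite mulrDr -mulrDl -rmorphD half rmorph1 mul1r.
by rewrite x2 mulr0.
Qed.

Lemma fermionic_duality :
  rdet (fun i j => (if i == j then P i else 0)
    - \sum_a Xi a * (h * h * iota (xi_op (a, j) *m del_op (a, i)))) *
  Pbi *
  rdet (fun a c => (if a == c then X a else 0)
    + \sum_i Pi i * (h * h * iota (xi_op (c, i) *m del_op (a, i)))) =
  \prod_a X a.
Proof.
pose psi i := gen (inl i); pose om a := gen (inr a).
have hiotaP A i : comm (emb (h * iota A)) (emb (P i)).
  by apply/emb_comm/commr_sym/commrM; [exact: hC|apply/commr_sym/iotaP].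
have hiotaX A a : comm (emb (h * iota A)) (emb (X a)).
  by apply/emb_comm/commr_sym/commrM; [exact: hC|apply/commr_sym/iotaX].
have gen_xi x a i : gen x * xi a i = - (xi a i * gen x).
  exact/gen_odd/parity_xi.
have gen_de x a i : gen x * de a i = - (de a i * gen x).
  exact/gen_odd/parity_del.
have deN a i c j : de a i * de c j = - (de c j * de a i).
  by rewrite !hiotaM del_anti rmorphN mulrN embN.
have xiN a i c j : xi a i * xi c j = - (xi c j * xi a i).
  by rewrite !hiotaM xi_anti rmorphN mulrN embN.
have dexi a i c j : de a i * xi c j + xi c j * de a i =
    if (a == c) && (i == j) then kap else 0.
  rewrite !hiotaM -embD -mulrDr -rmorphD del_xi xpair_eqE.
  by case: andP => _; rewrite ?rmorph1 ?mulr1 // raddf0 rmorph0 mulr0 emb0.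
have torsL (x : L) : x = - x -> x = 0.
  by move=> xN; apply/matrixP => i j; rewrite mxE; apply: torsE; rewrite {1}xN mxE.
have kapC u : comm u kap.
  by apply/commr_sym/scalar_mx_comm => i j; apply/commr_sym/commrM; exact: hC.
have PXL i a : emb (P i) * emb (X a) = emb (X a) * emb (P i) + kap.
  by rewrite !embM PX embD.
have inv u v : u * v = 1 -> emb u * emb v = 1 by move=> uv; rewrite embM uv.
have embC u v : comm u v -> comm (emb u) (emb v) by exact: emb_comm.
have PbL : (\prod_i emb (P i)) * emb Pbi = 1 by rewrite -emb_prod inv.
have PbL' : emb Pbi * (\prod_i emb (P i)) = 1 by rewrite -emb_prod inv.
have := @rdet_mat_n_mat_k L k n (fun i => emb (P i)) (fun i => emb (Pi i)) psi
  (fun a => emb (X a)) (fun a => emb (Xi a)) om xi de kap torsL kapC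
  (fun i => inv _ _ (PK i)) (fun i => inv _ _ (PiK i))
  (fun a => inv _ _ (XK a)) (fun a => inv _ _ (XiK a))
  (fun i j => embC _ _ (PP i j)) (fun a c => embC _ _ (XX a c)) PXL
  (fun i j => emb_gen _ (fun A => iotaP A i)) (fun i a => emb_gen _ (fun A => iotaP A i))
  (fun i a j => hiotaP _ i) (fun i a j => hiotaP _ i)
  (fun a j => emb_gen _ (fun A => iotaX A a)) (fun a c => emb_gen _ (fun A => iotaX A a))
  (fun a c j => hiotaX _ a) (fun a c j => hiotaX _ a)
  (fun i j => genN _ _) (fun a c => genN _ _) deN xiN
  (fun i a j => gen_de _ a j) (fun i a j => gen_xi _ a j)
  (fun c a j => gen_de _ a j) (fun c a j => gen_xi _ a j) dexi
  (emb Pbi) PbL PbL'.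
set A1 := rdet (fun i j => (if i == j then P i else 0) - _).
set A2 := rdet (fun a c => (if a == c then X a else 0) + _).
have -> : rdet (mat_n (fun i => emb (P i)) (fun a => emb (Xi a)) xi de) = emb A1.
  rewrite /A1 emb_rdet; apply: eq_rdet => i j; rewrite embB; congr (_ - _).
    by case: eqP => _; rewrite ?emb0.
  by rewrite emb_sum; apply: eq_bigr => a _; rewrite hiotaM embM.
have -> : rdet (mat_k (fun i => emb (Pi i)) (fun a => emb (X a)) xi de) = emb A2.
  rewrite /A2 emb_rdet; apply: eq_rdet => a c; rewrite embD; congr (_ + _).
    by case: eqP => _; rewrite ?emb0.
  by rewrite emb_sum; apply: eq_bigr => i _; rewrite hiotaM embM.
rewrite -emb_prod !embM => /eqP; rewrite -subr_eq0 -mulrBl -embB.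
have -> : (\prod_i psi i) * (\prod_a om a) =
    \prod_(x <- [seq inl i | i <- index_enum 'I_n] ++ [seq inr a | a <- index_enum 'I_k]) gen x.
  by rewrite big_cat !big_map.
move/eqP; set Z := A1 * Pbi * A2 - _ => Z0.
suff /matrixP Z1 : emb Z = 0.
  apply/eqP; rewrite -subr_eq0; apply/eqP.
  have p : 'I_N := enum_rank (set0 : {set 'I_1 * 'I_(n + k)}).
  by have := Z1 p p; rewrite !mxE eqxx.
(* [Z] is built from [h], the [P i], the [X a], their inverses and even operators. Applied below to
   the parity and to scalar matrices, this makes [Z] commute with every [ann x]. *)
have evenZ (B : EndP k n) :
    (forall c e, comm B (xi_op c *m del_op e)) -> comm (iota B) Z.
  move=> BC; have iotahC c e : comm (iota B) (h * h * iota (xi_op c *m del_op e)).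
    apply: commrM; first by apply: commrM; exact: hC.
    rewrite /comm -!rmorphM.
    by congr (iota _); apply: BC.
  have BPi i : comm (iota B) (Pi i) by apply: (comm_inv (PiK i) (PK i)).
  have BXi a : comm (iota B) (Xi a) by apply: (comm_inv (XiK a) (XK a)).
  have Brdet m (M : 'I_m -> 'I_m -> E) : (forall i j, comm (iota B) (M i j)) ->
      comm (iota B) (rdet M).
    move=> BM; apply: commr_sum => s _; apply: commrM; first exact: commr_sign.
    by apply: commr_prod.
  apply: commrB; last by apply: commr_prod.
  apply: commrM; first apply: commrM.
  - apply: Brdet => i j; apply: commrB; first by case: eqP => // _; apply: commr0.
    by apply: commr_sum => a _; apply: commrM.
  - by apply: (comm_inv PbiK PbK); apply: commr_prod.
  - apply: Brdet => a c; apply: commrD; first by case: eqP => // _; apply: commr0.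
    by apply: commr_sum => i _; apply: commrM.
apply: (cancel_prod_anti (ys := ann) _ _ _ _ Z0).
- rewrite cat_uniq !map_inj_uniq ?index_enum_uniq => [|x y []|x y []] //.
  rewrite andbT; apply/hasPn => x /mapP[a _ ->]; apply/negP => /mapP[i _]; discriminate.
- by move=> x; rewrite ann_gen eqxx.
- move=> x y xy; have := ann_gen x y; rewrite (negPf xy) => /eqP.
  by rewrite addr_eq0 => /eqP ->; rewrite opprK.
move=> x; apply/commr_sym/commrM.
  apply/emb_comm/commr_sym/evenZ => c e; rewrite /comm.
  apply/esym; rewrite -[LHS]mulmxA [del_op e *m _](_ : _ = - (parity k n *m del_op e)).
    by rewrite mulmxN mulmxA -mulNmx -parity_xi -mulmxA.
  by rewrite parity_del opprK.
apply: emb_lift => c; apply/commr_sym/evenZ => e f.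
by rewrite /comm; apply/esym/scalar_mxC.
Qed.
End FermionicDuality.

(** * From symbols to elements of a ring *)

Section OperatorsOfSymbols.
Variables (A E : pzRingType) (iota : {rmorphism A -> E}).
Variables (u ui v h : E) (d : nat).
Local Notation comm := GRing.comm.
Hypothesis hC : forall w, comm w h.
Hypothesis hnil : h ^+ d.+1 = 0.
Hypotheses (uK : u * ui = 1) (uiK : ui * u = 1).
Hypothesis vu : v * u = u * v + h * h.
Hypotheses (iotau : forall a, comm (iota a) u) (iotav : forall a, comm (iota a) v).

Local Notation y := (h * ui).

Lemma iota_y a : comm (iota a) y.
Proof. by apply: commrM; [exact: hC|apply: (comm_inv uiK uK)]. Qed.

Lemma y_exp j : y ^+ j = h ^+ j * ui ^+ j.
Proof. by apply: exprMn_comm; apply/commr_sym/hC. Qed.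

Lemma y_nil j : (d < j)%N -> y ^+ j = 0.
Proof. by move=> dj; rewrite y_exp -(subnK dj) exprD hnil mulr0 mul0r. Qed.

(** With [y = 1/x] this is d/dx x^-j = - j x^(-j-1), scaled by [h]. *)
Lemma v_y j : v * y ^+ j = y ^+ j * v - h * y ^+ j.+1 *+ j.
Proof.
have vy : v * y = y * v - h * (y * y).
  have vui : v * ui = ui * v - ui * (h * h) * ui.
    have -> : ui * v = ui * (v * u) * ui by rewrite -!mulrA uK mulr1.
    by rewrite vu mulrDr mulrDl [ui * (u * v)]mulrA uiK mul1r addrK.
  rewrite mulrA hC -mulrA vui mulrBr !mulrA; congr (_ - _).
  by rewrite -!mulrA; congr (_ * _); rewrite !mulrA -!hC.
move: (hC y) vy; move: (h * ui) => Y Yh vy.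
elim: j => [|j IHj]; first by rewrite !expr0 mulr1 mul1r subr0.
rewrite exprS mulrA vy mulrBl -mulrA IHj mulrBr [Y * (_ * v)]mulrA -exprS.
have -> : Y * (h * Y ^+ j.+1 *+ j) = h * Y ^+ j.+2 *+ j.
  by rewrite mulrnAr mulrA Yh -mulrA -exprS.
have -> : h * (Y * Y) * Y ^+ j = h * Y ^+ j.+2 by rewrite -!mulrA -!exprS.
by rewrite mulrSr opprD addrA.
Qed.

(** Evaluation at [y], which is 1/x when [u] is [h] times x. The powers of [y] beyond [d] vanish, so
    the cut-off loses nothing and evaluation is multiplicative. *)
Definition ser (f : series A) : E := \sum_(j < d.+1) iota (f j) * y ^+ j.

Lemma eq_ser f g : (forall j, f j = g j) -> ser f = ser g.
Proof. by move=> fg; apply: eq_bigr => j _; rewrite fg. Qed.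

Lemma serD f g : ser (fun j => f j + g j) = ser f + ser g.
Proof. by rewrite -big_split; apply: eq_bigr => j _; rewrite rmorphD mulrDl. Qed.

Lemma serN f : ser (fun j => - f j) = - ser f.
Proof. by rewrite -sumrN; apply: eq_bigr => j _; rewrite rmorphN mulNr. Qed.

Lemma ser0 f : (forall j, f j = 0) -> ser f = 0.
Proof. by move=> f0; apply: big1 => j _; rewrite f0 rmorph0 mul0r. Qed.

Lemma serC f : (forall j, (0 < j)%N -> f j = 0) -> ser f = iota (f 0).
Proof.
move=> f0; rewrite /ser big_ord_recl mulr1 big1 ?addr0 // => j _.
by rewrite f0 // rmorph0 mul0r.
Qed.

Lemma ser_mul f g : ser (smul f g) = ser f * ser g.
Proof.
pose G i s := iota (f i) * iota (g (s - i)%N) * y ^+ s.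
transitivity (\sum_(i < d.+1) \sum_(s < d.+1 | (i <= s)%N) G i s).
  rewrite (exchange_big_dep xpredT) //=; apply: eq_bigr => s _.
  rewrite rmorph_sum mulr_suml (big_ord_widen d.+1 (fun i => iota (f i * g (s - i)%N) * y ^+ s)) //.
  by apply: eq_big => i; rewrite ?ltnS // => _; rewrite rmorphM.
rewrite mulr_suml; apply: eq_bigr => i _.
have -> : \sum_(s < d.+1 | (i <= s)%N) G i s = \sum_(i <= s < d.+1) G i s.
  by rewrite big_geq_mkord.
(* The added terms contain [y ^ s] with [s > d]; after a shift by [i] the range no longer depends on
   [i]. *)
have -> : \sum_(i <= s < d.+1) G i s = \sum_(0 + i <= s < d.+1 + i) G i s.
  rewrite add0n [RHS](@big_cat_nat _ _ _ d.+1) ?leq_addr //=; last exact: ltnW.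
  rewrite [X in _ = _ + X]big_nat_cond [X in _ + X]big1 ?addr0 // => s /andP[/andP[ds _] _].
  by rewrite /G y_nil // mulr0.
rewrite big_addn addnK big_mkord mulr_sumr; apply: eq_bigr => j _.
rewrite /G addnK addnC exprD !mulrA; congr (_ * _); rewrite -!mulrA; congr (_ * _).
by apply: commrX; apply: iota_y.
Qed.

Lemma v_ser f : v * ser f = ser f * v + h * ser (sderiv f).
Proof.
rewrite mulr_sumr mulr_suml.
have Ej j : v * (iota (f j) * y ^+ j) =
    iota (f j) * y ^+ j * v - h * (iota (f j) * y ^+ j.+1 *+ j).
  rewrite mulrA -iotav -mulrA v_y mulrBr mulrA; congr (_ - _).
  by rewrite !mulrnAr [in LHS]mulrA hC -[in LHS]mulrA.
rewrite (eq_bigr _ (fun (j : 'I__) _ => Ej j)) sumrB -mulr_sumr; congr (_ + _).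
rewrite -mulrN; congr (_ * _); rewrite big_ord_recr /= y_nil // mulr0 mul0rn addr0.
rewrite /ser big_ord_recl rmorph0 mul0r add0r -sumrN; apply: eq_bigr => j _.
by rewrite /= rmorphN rmorphMn mulNr mulrnAl.
Qed.

(* The operator [h ^ N * Q], where [x = u / h] and [d/dx = v / h]. *)
Definition symop N (Q : dop A) : E :=
  \sum_(m < N.+1) ser (dcoef Q m) * h ^+ (N - m) * v ^+ m.

Lemma dcoef_default (Q : dop A) m j : (size Q <= m)%N -> dcoef Q m j = 0.
Proof. by move=> le_m; rewrite /dcoef nth_default. Qed.

Lemma dcoef_dadd (P Q : dop A) m j : dcoef (dadd P Q) m j = dcoef P m j + dcoef Q m j.
Proof.
case: (ltnP m (maxn (size P) (size Q))) => [lt_m|]; first by rewrite {1}/dcoef nth_mkseq.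
move=> le_m; rewrite dcoef_default ?size_mkseq //.
by move: le_m; rewrite geq_max => /andP[Pm Qm]; rewrite !dcoef_default ?addr0.
Qed.

Lemma dcoef_dopp (P : dop A) m j : dcoef (dopp P) m j = - dcoef P m j.
Proof.
case: (ltnP m (size P)) => lt_m; last by rewrite !dcoef_default ?size_map ?oppr0.
by rewrite {1}/dcoef (nth_map (sr0 A)).
Qed.

Let smul0l (f g : series A) j : (forall i, f i = 0) -> smul f g j = 0.
Proof. by move=> f0; apply: big1 => i _; rewrite f0 mul0r. Qed.
Let smul0r (f g : series A) j : (forall i, g i = 0) -> smul f g j = 0.
Proof. by move=> g0; apply: big1 => i _; rewrite g0 mulr0. Qed.
Let sderiv0 (f : series A) j : (forall i, f i = 0) -> sderiv f j = 0.
Proof. by case: j => // j f0; rewrite /= f0 mul0rn oppr0. Qed.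

(** The products in [drdet] are nested to the right, so the left factor is always a matrix entry, of
    order at most one, and the Leibniz sum stops at the first derivative. *)
Lemma dcoef_dmul2 (P Q : dop A) p j : (size P <= 2)%N ->
  dcoef (dmul P Q) p j = smul (dcoef P 0) (dcoef Q p) j
    + (if p is p'.+1 then smul (dcoef P 1) (dcoef Q p') j else 0)
    + smul (dcoef P 1) (sderiv (dcoef Q p)) j.
Proof.
move=> P2; case: (ltnP p (size P + size Q)) => [lt_p|le_p]; last first.
  rewrite dcoef_default ?size_mkseq // smul0r; last first.
    by move=> i; rewrite dcoef_default // (leq_trans _ le_p) ?leq_addl.
  rewrite add0r [X in _ + X]smul0r ?addr0; last first.
    move=> i; apply: sderiv0 => i'.
    by rewrite dcoef_default // (leq_trans _ le_p) ?leq_addl.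
  case: p le_p => // p le_p; case: (ltnP 1 (size P)) => [P_2|P_1]; last first.
    by rewrite smul0l // => i; rewrite dcoef_default.
  by rewrite smul0r // => i; rewrite dcoef_default //; lia.
rewrite {1}/dcoef nth_mkseq //.
pose F m := \sum_(l < size Q) \sum_(r < m.+1) if (m + l - r == p)%N
  then smul (dcoef P m) (sderivn r (dcoef Q l)) j *+ 'C(m, r) else 0.
rewrite -/(\sum_(m < size P) F m) (_ : \sum_(m < size P) F m = \sum_(m < 2) F m); last first.
  rewrite (big_ord_widen 2 F) // big_mkcond; apply: eq_bigr => m _.
  case: ltnP => // Pm; rewrite /F big1 // => l _; apply: big1 => r _.
  by case: eqP => // _; rewrite smul0l ?mul0rn // => i; rewrite dcoef_default.
have pick q (G : series A -> A) : (forall f, (forall i, f i = 0) -> G f = 0) ->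
    \sum_(l < size Q) (if (l == q :> nat) then G (dcoef Q l) else 0) = G (dcoef Q q).
  move=> G0; case: (ltnP q (size Q)) => [lt_q|le_q].
    rewrite (bigD1 (Ordinal lt_q)) //= eqxx big1 ?addr0 // => l lq.
    by rewrite ifN.
  rewrite big1 => [|l _]; last by rewrite ifN // neq_ltn (leq_trans (ltn_ord l) le_q).
  by rewrite G0 // => i; rewrite dcoef_default.
rewrite big_ord_recl big_ord1 /F {F} -addrA; congr (_ + _).
  rewrite -(pick p (fun f => smul (dcoef P 0) f j)) => [|f f0]; last exact: smul0r.
  by apply: eq_bigr => l _; rewrite big_ord1 add0n subn0 bin0 mulr1n.
rewrite (eq_bigr (fun l : 'I_(size Q) =>
    (if (l.+1 == p :> nat) then smul (dcoef P 1) (dcoef Q l) j else 0) +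
    (if (l == p :> nat) then smul (dcoef P 1) (sderiv (dcoef Q l)) j else 0))); last first.
  move=> l _; rewrite big_ord_recl big_ord1 /= subn0 add1n subn1.
  by rewrite bin0 bin1 !mulr1n.
rewrite big_split; congr (_ + _).
  case: p {lt_p} => [|p]; first by rewrite big1.
  rewrite -(pick p (fun f => smul (dcoef P 1) f j)) => [|f f0]; last exact: smul0r.
  by apply: eq_bigr => l _.
rewrite -(pick p (fun f => smul (dcoef P 1) (sderiv f) j)) // => f f0.
by apply: smul0r => i; apply: sderiv0.
Qed.

Lemma symop_dadd N (P Q : dop A) : symop N (dadd P Q) = symop N P + symop N Q.
Proof.
rewrite /symop -big_split; apply: eq_bigr => m _; rewrite /= -!mulrDl -serD.
by congr (_ * _ * _); apply: eq_ser => j; rewrite dcoef_dadd.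
Qed.

Lemma symop_dopp N (P : dop A) : symop N (dopp P) = - symop N P.
Proof.
rewrite /symop -sumrN; apply: eq_bigr => m _; rewrite -!mulNr -serN.
by congr (_ * _ * _); apply: eq_ser => j; rewrite dcoef_dopp.
Qed.

Lemma symop_d0 N : symop N (d0 A) = 0.
Proof. by apply: big1 => m _; rewrite ser0 ?mul0r // => j; rewrite dcoef_default. Qed.

Lemma symop_d1 : symop 0 (d1 A) = 1.
Proof.
rewrite /symop big_ord1 !mulr1 serC /dcoef /= /sr1 ?eqxx ?rmorph1 // => j j0.
by rewrite ifN // -lt0n.
Qed.

Lemma symop1 (P : dop A) : symop 1 P = ser (dcoef P 0) * h + ser (dcoef P 1) * v.
Proof. by rewrite /symop big_ord_recl big_ord1 /= !expr1 !expr0 !mulr1. Qed.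

(** The power [h ^ N.+1] is shared out as [h] for [P] and [h ^ N] for [Q]; the vanishing of [Q]
    above order [N] ensures that [symop N Q] sees all of [Q]. *)
Lemma symop_dmul N (P Q : dop A) : (size P <= 2)%N ->
  (forall m j, (N < m)%N -> dcoef Q m j = 0) ->
  symop N.+1 (dmul P Q) = symop 1 P * symop N Q.
Proof.
move=> P2 QN; rewrite symop1 mulr_sumr.
(* Contributions of the order zero part of [P], of its d/dx moved past the coefficients of [Q], and
   of its d/dx applied to them. *)
pose T0 m := ser (smul (dcoef P 0) (dcoef Q m)) * h ^+ (N.+1 - m) * v ^+ m.
pose T1 m := ser (smul (dcoef P 1) (dcoef Q m)) * h ^+ (N - m) * v ^+ m.+1.
pose T2 m := ser (smul (dcoef P 1) (sderiv (dcoef Q m))) * h ^+ (N.+1 - m) * v ^+ m.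
transitivity (\sum_(m < N.+2) (T0 m + (if nat_of_ord m is m'.+1 return E then T1 m' else 0) + T2 m)).
  apply: eq_bigr => m _.
  have -> : (if nat_of_ord m is m'.+1 return E then T1 m' else 0) =
      ser (if nat_of_ord m is m'.+1 then smul (dcoef P 1) (dcoef Q m') else sr0 A)
        * h ^+ (N.+1 - m) * v ^+ m.
    case: m => [[|m] mN] /=; first by rewrite ser0 // !mul0r.
    by rewrite /T1 subSS.
  rewrite /T0 /T2 -!mulrDl -!serD; congr (_ * _ * _); apply: eq_ser => j.
  by rewrite dcoef_dmul2 //; case: (nat_of_ord m).
have TN : T0 N.+1 = 0 /\ T2 N.+1 = 0.
  split; rewrite /T0 /T2 ser0 ?mul0r // => j; apply: smul0r => i; first exact: QN.
  by apply: sderiv0 => i'; apply: QN.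
rewrite !big_split /=.
rewrite [\sum_(m < N.+2) T0 m]big_ord_recr [\sum_(m < N.+2) T2 m]big_ord_recr /=.
rewrite TN.1 TN.2 !addr0 [X in _ + X + _]big_ord_recl /= add0r -!big_split /=.
apply: eq_bigr => m _; rewrite /T0 /T1 /T2 !ser_mul.
have mN : (N.+1 - m)%N = (N - m).+1 by rewrite subSn // -ltnS.
rewrite mN exprS mulrDl -[ser (dcoef P 1) * v * _]mulrA !mulrA.
have -> : ser (dcoef P 1) * v * ser (dcoef Q m) * h ^+ (N - m) * v ^+ m =
  ser (dcoef P 1) * ser (dcoef Q m) * h ^+ (N - m) * (v * v ^+ m) +
  ser (dcoef P 1) * ser (sderiv (dcoef Q m)) * h * h ^+ (N - m) * v ^+ m.
  rewrite -(mulrA _ v) v_ser mulrDr !mulrDl; congr (_ + _).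
    rewrite -!mulrA; congr (_ * (_ * _)); rewrite !mulrA; congr (_ * _).
    exact: commrX (hC _).
  congr (_ * _ * _); rewrite [h * _](_ : _ = ser (sderiv (dcoef Q m)) * h); last by rewrite hC.
  by rewrite mulrA.
have -> : ser (dcoef P 0) * h * ser (dcoef Q m) = ser (dcoef P 0) * ser (dcoef Q m) * h.
  by rewrite -!mulrA hC.
rewrite -exprS; abel.
Qed.

Section Determinant.
Variable Sc : A -> Prop.
Hypotheses (Sc0 : Sc 0) (Sc1 : Sc 1) (ScN : forall a, Sc a -> Sc (- a)).
Hypotheses (ScD : forall a b, Sc a -> Sc b -> Sc (a + b)).
Hypotheses (ScM : forall a b, Sc a -> Sc b -> Sc (a * b)).

(* The coefficients of [Q] that are not among the generators of the Bethe
   algebra are scalar. *)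
Definition regular N (Q : dop A) := [/\ forall m j, (N < m)%N -> dcoef Q m j = 0,
  forall m, Sc (dcoef Q m 0) & forall j, Sc (dcoef Q N j)].

Let smul_Sc f g j : (forall i, Sc (f i)) -> (forall i, Sc (g i)) -> Sc (smul f g j).
Proof.
move=> fS gS; rewrite /smul; elim: (index_enum _) => [|i s IHs].
  by rewrite big_nil.
by rewrite big_cons; apply: ScD => //; apply: ScM.
Qed.

Lemma regular_dmul N (P Q : dop A) : (size P <= 2)%N ->
  regular 1 P -> regular N Q -> regular N.+1 (dmul P Q).
Proof.
move=> P2 [P0 PS PT] [Q0 QS QT].
have QE j : (smul (dcoef P 0) (dcoef Q N.+1) j = 0) * (smul (dcoef P 1) (sderiv (dcoef Q N.+1)) j = 0).
  split; apply: smul0r => i; first exact: Q0.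
  by apply: sderiv0 => i'; apply: Q0.
split=> [[|m] j mN|m|j] //; rewrite dcoef_dmul2 //.
- rewrite !smul0r ?addr0 // => i; try by apply: Q0; lia.
  by apply: sderiv0 => i'; apply: Q0; lia.
- have Z f g : Sc (f 0%N) -> Sc (g 0%N) -> Sc (smul f g 0).
    by move=> f0 g0; rewrite /smul big_ord1; apply: ScM.
  apply: ScD; last exact: Z.
  by apply: ScD; [exact: Z|case: m => // m; exact: Z].
by rewrite !QE addr0 add0r; apply: smul_Sc.
Qed.

Lemma regular_d1 : regular 0 (d1 A).
Proof.
split=> [[|m] j //|[|m]|j] //=; rewrite /dcoef /= ?nth_nil //.
by rewrite /sr1; case: eqP.
Qed.

Lemma regular_dadd N (P Q : dop A) : regular N P -> regular N Q -> regular N (dadd P Q).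
Proof.
move=> [P0 PS PT] [Q0 QS QT]; split=> [m j mN|m|j]; rewrite dcoef_dadd.
- by rewrite P0 // Q0 // addr0.
- exact: ScD.
exact: ScD.
Qed.

Lemma regular_dopp N (P : dop A) : regular N P -> regular N (dopp P).
Proof.
move=> [P0 PS PT]; split=> [m j mN|m|j]; rewrite dcoef_dopp.
- by rewrite P0 // oppr0.
- exact: ScN.
exact: ScN.
Qed.

Lemma regular_d0 N : regular N (d0 A).
Proof. by split=> *; rewrite dcoef_default. Qed.

Variables (N : nat) (M : 'I_N -> 'I_N -> dop A).
Hypothesis M2 : forall i j, (size (M i j) <= 2)%N.
Hypothesis Mreg : forall i j, regular 1 (M i j).

Let prodM (f : 'I_N -> 'I_N) (s : seq 'I_N) :
  let Q := foldr (@dmul A) (d1 A) [seq M i (f i) | i <- s] in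
  regular (size s) Q /\ symop (size s) Q = \prod_(i <- s) symop 1 (M i (f i)).
Proof.
elim: s => [|i s [IH1 IH2]] /=; first by rewrite big_nil symop_d1; split=> //; apply: regular_d1.
split; first exact: regular_dmul.
by rewrite big_cons symop_dmul ?IH2 //; case: IH1.
Qed.

Lemma drdetP : regular N (drdet M) /\ symop N (drdet M) = rdet (fun i j => symop 1 (M i j)).
Proof.
pose T (s : {perm 'I_N}) := (if odd_perm s then @dopp A else id)
  (foldr (@dmul A) (d1 A) [seq M i (s i) | i <- enum 'I_N]).
have TP s : regular N (T s) /\ symop N (T s) = (-1) ^+ s * \prod_i symop 1 (M i (s i)).
  have [Rg Sy] := prodM s (enum 'I_N); rewrite size_enum_ord in Rg Sy.
  have eE : index_enum 'I_N = enum 'I_N by rewrite [index_enum _]unlock enumT.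
  rewrite -[in RHS]eE in Sy.
  rewrite /T; case: (odd_perm s); rewrite ?expr0 ?expr1 ?mul1r ?mulN1r //.
  by rewrite symop_dopp Sy; split=> //; apply: regular_dopp.
have -> : rdet (fun i j => symop 1 (M i j)) =
    \sum_(s <- enum {perm 'I_N}) (-1) ^+ s * \prod_i symop 1 (M i (s i)).
  by rewrite big_enum.
rewrite /drdet -/(map T _); elim: (enum {perm 'I_N}) => [|s e [IH1 IH2]] /=.
  by rewrite big_nil symop_d0; split=> //; apply: regular_d0.
have [Rg Sy] := TP s; split; first exact: regular_dadd.
by rewrite big_cons symop_dadd IH2 Sy.
Qed.
End Determinant.
End OperatorsOfSymbols.

(** * A ring of pseudodifferential operators *)

(* A function on [int * int * nat] stands for a combination of the symbols
   [(h * x) ^ i * (h * d/dx) ^ j * h ^ l], where [h ^ d.+1 = 0]; the operators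
   below are those commuting with [h]. *)
Section Operators.
Variables (R : pzRingType) (d : nat).
Definition lfun := int -> int -> nat -> R.

Definition hshift (f : lfun) : lfun := fun i j l =>
  if l is l'.+1 then if (l' < d)%N then f i j l' else 0 else 0.

Record oper := Oper {
  op_fun :> lfun -> lfun;
  op_add : forall f g, op_fun (fun i j l => f i j l + g i j l) =
    (fun i j l => op_fun f i j l + op_fun g i j l);
  op_h : forall f, op_fun (hshift f) = hshift (op_fun f) }.

Lemma oper_eq (S T : oper) : (forall f i j l, S f i j l = T f i j l) -> S = T.
Proof.
case: S T => [S Sa Sh] [T Ta Th] /= ST.
have eST : S = T.
  by apply: funext => f; apply: funext => i; apply: funext => j; apply: funext => l.
by case: T / eST Ta Th {ST} => Ta Th; congr Oper; apply: Prop_irrelevance.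
Qed.

HB.instance Definition _ := gen_eqMixin oper.
HB.instance Definition _ := gen_choiceMixin oper.

Local Ltac lfun_ext := apply: funext => i; apply: funext => j; apply: funext => l.

Lemma hshift_add f g : hshift (fun i j l => f i j l + g i j l) =
  (fun i j l => hshift f i j l + hshift g i j l).
Proof. by lfun_ext; case: l => [|l] /=; rewrite ?addr0 //; case: ifP; rewrite ?addr0. Qed.

Program Definition oper0 : oper := @Oper (fun _ _ _ _ => 0) _ _.
Next Obligation. by lfun_ext; rewrite addr0. Qed.
Next Obligation. by lfun_ext; case: l => [|l] //=; case: ifP. Qed.

Program Definition oper_opp (S : oper) : oper := @Oper (fun f i j l => - S f i j l) _ _.
Next Obligation. by lfun_ext; rewrite op_add opprD. Qed.
Next Obligation.
by lfun_ext; rewrite op_h; case: l => [|l] /=; rewrite ?oppr0 //; case: ifP; rewrite ?oppr0.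
Qed.

Program Definition oper_add (S T : oper) : oper :=
  @Oper (fun f i j l => S f i j l + T f i j l) _ _.
Next Obligation. by lfun_ext; rewrite !op_add addrACA. Qed.
Next Obligation. by rewrite hshift_add !op_h. Qed.

Program Definition oper_mul (S T : oper) : oper := @Oper (fun f => S (T f)) _ _.
Next Obligation. by rewrite !op_add. Qed.
Next Obligation. by rewrite !op_h. Qed.

Program Definition oper1 : oper := @Oper id _ _.

Fact oper_addA : associative oper_add.
Proof. by move=> S T U; apply: oper_eq => f i j l /=; rewrite addrA. Qed.
Fact oper_addC : commutative oper_add.
Proof. by move=> S T; apply: oper_eq => f i j l /=; rewrite addrC. Qed.
Fact oper_add0 : left_id oper0 oper_add.
Proof. by move=> S; apply: oper_eq => f i j l /=; rewrite add0r. Qed.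
Fact oper_addN : left_inverse oper0 oper_opp oper_add.
Proof. by move=> S; apply: oper_eq => f i j l /=; rewrite addNr. Qed.
HB.instance Definition _ :=
  GRing.isZmodule.Build oper oper_addA oper_addC oper_add0 oper_addN.

Fact oper_mulA : associative oper_mul.
Proof. by move=> S T U; apply: oper_eq. Qed.
Fact oper_mul1 : left_id oper1 oper_mul.
Proof. by move=> S; apply: oper_eq. Qed.
Fact oper_mulr1 : right_id oper1 oper_mul.
Proof. by move=> S; apply: oper_eq. Qed.
Fact oper_mulDl : left_distributive oper_mul +%R.
Proof. by move=> S T U; apply: oper_eq. Qed.
Fact oper_mulDr : right_distributive oper_mul +%R.
Proof. by move=> S T U; apply: oper_eq => f i j l /=; rewrite op_add. Qed.
HB.instance Definition _ := GRing.Zmodule_isPzRing.Build oper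
  oper_mulA oper_mul1 oper_mulr1 oper_mulDl oper_mulDr.

Lemma op_sum (I : Type) (s : seq I) (F : I -> oper) f i j l :
  (\sum_(x <- s) F x : oper) f i j l = \sum_(x <- s) F x f i j l.
Proof. by elim: s => [|x s IHs]; rewrite ?big_nil // !big_cons -IHs. Qed.

Lemma op_mulE (S T : oper) f : (S * T : oper) f = S (T f). Proof. by []. Qed.

Program Definition hop : oper := @Oper hshift hshift_add _.

Program Definition iota_op (a : R) : oper := @Oper (fun f i j l => a * f i j l) _ _.
Next Obligation. by lfun_ext; rewrite mulrDr. Qed.
Next Obligation.
by lfun_ext; case: l => [|l] /=; rewrite ?mulr0 //; case: ifP; rewrite ?mulr0.
Qed.

Fact iota_op_zmod : zmod_morphism iota_op.
Proof. by move=> a b; apply: oper_eq => f i j l /=; rewrite mulrBl. Qed.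
Fact iota_op_monoid : monoid_morphism iota_op.
Proof. by split=> [|a b]; apply: oper_eq => f i j l /=; rewrite ?mul1r ?mulrA. Qed.
HB.instance Definition _ := GRing.isZmodMorphism.Build R oper iota_op iota_op_zmod.
HB.instance Definition _ := GRing.isMonoidMorphism.Build R oper iota_op iota_op_monoid.

Definition shift_op (p q : int) : oper.
Proof.
by refine (@Oper (fun f i j l => f (i - p) (j - q) l) _ _).
Defined.

(** Derivative of a symbol in the variable h x. As symbols carry h x on the left, multiplying by h
    d/dx from the left is a shift of [j] plus h^2 times this operator. *)
Program Definition diff_op : oper := @Oper (fun f i j l => f (i + 1) j l *~ (i + 1)) _ _.
Next Obligation. by lfun_ext; rewrite mulrzDl. Qed.
Next Obligation.
by lfun_ext; case: l => [|l] /=; rewrite ?mul0rz //; case: ifP; rewrite ?mul0rz.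
Qed.

Lemma hop_comm (S : oper) : GRing.comm S hop.
Proof. by apply: oper_eq => f i j l; rewrite !op_mulE /= op_h. Qed.

Let hop_expS m f i j l : (hop ^+ m.+1 : oper) f i j l =
  if l is l'.+1 then if (l' < d)%N then (hop ^+ m : oper) f i j l' else 0 else 0.
Proof. by rewrite exprS op_mulE. Qed.

Lemma hop_expE m f i j l : (l <= d)%N ->
  (hop ^+ m : oper) f i j l = if (m <= l)%N then f i j (l - m)%N else 0.
Proof.
elim: m l => [|m IHm] l ld; first by rewrite subn0.
by rewrite hop_expS; case: l ld => // l ld; rewrite ld IHm ?subSS // ltnW.
Qed.

Lemma hop_nil : hop ^+ d.+1 = 0.
Proof.
apply: oper_eq => f i j l; case: (leqP l d) => ld.
  by rewrite hop_expE // ltnNge ld.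
by rewrite hop_expS; case: l ld => // l; rewrite ltnS ltnNge => ->.
Qed.

Lemma shift_opM p q p' q' : shift_op p q * shift_op p' q' = shift_op (p + p') (q + q').
Proof. by apply: oper_eq => f i j l; rewrite op_mulE /= !opprD !addrA. Qed.

Lemma shift_op0 : shift_op 0 0 = 1.
Proof. by apply: oper_eq => f i j l /=; rewrite !subr0. Qed.

Lemma diff_shift q : diff_op * shift_op 1 q = shift_op 1 q * diff_op + shift_op 0 q.
Proof.
apply: oper_eq => f i j l /=; rewrite addrK subrK subr0.
by rewrite mulrzDr mulr1z.
Qed.
End Operators.

(** * Bethe matrices in the ring of operators *)

Section NilpotentPerturbation.
Variables (E : pzRingType) (h : E) (d : nat).
Local Notation comm := GRing.comm.
Hypothesis hC : forall w, comm w h.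
Hypothesis hnil : h ^+ d.+1 = 0.
Variable O : E -> Prop.
Hypotheses (O1 : O 1) (OB : forall a b, O a -> O b -> O (a - b)).
Hypothesis OM : forall a b, O a -> O b -> O (a * b).

Let O0 : O 0. Proof. by rewrite -(subrr 1); apply: OB. Qed.

Lemma subring_add a b : O a -> O b -> O (a + b).
Proof. by move=> Oa Ob; rewrite -[b]opprK -[- b]sub0r; apply: OB => //; apply: OB. Qed.

Lemma subring_exp a m : O a -> O (a ^+ m).
Proof. by move=> Oa; elim: m => // m IHm; rewrite exprS; apply: OM. Qed.

Lemma subring_sum (I : Type) (s : seq I) (F : I -> E) :
  (forall x, O (F x)) -> O (\sum_(x <- s) F x).
Proof.
move=> OF; elim: s => [|x s IHs]; first by rewrite big_nil.
by rewrite big_cons; apply: subring_add.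
Qed.

Lemma subring_prod (I : Type) (s : seq I) (F : I -> E) :
  (forall x, O (F x)) -> O (\prod_(x <- s) F x).
Proof.
move=> OF; elim: s => [|x s IHs]; first by rewrite big_nil.
by rewrite big_cons; apply: OM.
Qed.

(** [W = 1 - vi * T] is a multiple of [h], hence nilpotent, and it is written with [T] and [vi]
    only; so its geometric series lies in [O] whatever [B] is. *)
Lemma unit_pert (v vi T B : E) : v * vi = 1 -> vi * v = 1 -> O vi -> O T ->
  T = v + h * B -> exists T', [/\ O T', T * T' = 1 & T' * T = 1].
Proof.
move=> vK viK Ovi OT TE; pose W := 1 - vi * T.
have WE : W = h * - (vi * B).
  by rewrite /W TE mulrDr viK opprD addNKr mulrA hC -mulrA mulrN.
have Wnil : W ^+ d.+1 = 0.
  by rewrite WE exprMn_comm ?hnil ?mul0r //; apply/commr_sym/hC.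
have viT : vi * T = 1 - W by rewrite opprB addrC subrK.
have OW : O W by apply: OB => //; apply: OM.
pose G := \sum_(i < d.+1) W ^+ i.
have WG : (1 - W) * G = 1.
  by rewrite -[1 - W]opprB mulNr -subrX1 Wnil sub0r opprK.
have GW : G * (1 - W) = 1.
  have WC : comm W G by apply: commr_sum => i _; apply/commrX.
  by rewrite -[RHS]WG mulrBl mulrBr mul1r mulr1 WC.
have TvW : T = v * (1 - W) by rewrite -viT mulrA vK mul1r.
exists (G * vi); split; first by apply: OM => //; apply: subring_sum => i; apply: subring_exp.
  by rewrite TvW -mulrA [_ * (G * vi)]mulrA WG mul1r.
by rewrite -mulrA viT.
Qed.

Let cong a b := exists B, a = b + h * B.

Let cong_refl a : cong a a. Proof. by exists 0; rewrite mulr0 addr0. Qed.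

Let congD a a' b b' : cong a a' -> cong b b' -> cong (a + b) (a' + b').
Proof. by move=> [B ->] [B' ->]; exists (B + B'); rewrite mulrDr addrACA. Qed.

Let congM a a' b b' : cong a a' -> cong b b' -> cong (a * b) (a' * b').
Proof.
move=> [B ->] [B' ->]; exists (a' * B' + B * b' + B * (h * B')).
have E1 : a' * (h * B') = h * (a' * B') by rewrite mulrA hC -mulrA.
rewrite !mulrDl !mulrDr E1 !mulrA; abel.
Qed.

(** Modulo [h] the matrix is [v] times the identity, and congruence modulo the central [h] respects
    sums and products. *)
Lemma rdet_pert m (v : E) (M : 'I_m -> 'I_m -> E) :
  (forall i j, exists B, M i j = (if i == j then v else 0) + h * B) ->
  exists B, rdet M = v ^+ m + h * B.
Proof.
move=> MB; suff <- : rdet (fun i j : 'I_m => if i == j then v else 0) = v ^+ m.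
  rewrite -/(cong _ _); apply: big_ind2 => [|a a' b b'|s _]; [exact: cong_refl|exact: congD|].
  apply: congM; first exact: cong_refl.
  apply: big_ind2 => [|a a' b b'|i _]; [exact: cong_refl|exact: congM|exact: MB].
rewrite /rdet (bigD1 (1%g : 'S_m)) //= [X in _ + X]big1 ?addr0 => [|s s1].
  rewrite odd_perm1 mul1r (eq_bigr (fun=> v)) => [|i _]; last by rewrite perm1 eqxx.
  by rewrite prodr_const card_ord.
have [i si] : exists i, i != s i.
  apply/existsP; apply: contraNT s1; rewrite negb_exists => /forallP s1.
  by apply/eqP/permP => i; rewrite perm1; have := s1 i; rewrite negbK => /eqP.
have F0 (F : 'I_m -> E) (t : seq 'I_m) : i \in t -> F i = 0 -> \prod_(j <- t) F j = 0.
  move=> it Fi; elim: t it => // j t IHt; rewrite inE big_cons => /orP[/eqP<-|/IHt->].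
    by rewrite Fi mul0r.
  by rewrite mulr0.
by rewrite (F0 _ _ (mem_index_enum i)) ?mulr0 // (negPf si).
Qed.
End NilpotentPerturbation.

Lemma prod_inv (E : pzRingType) (I : Type) (s : seq I) (F G : I -> E) :
  (forall i j, GRing.comm (F i) (F j)) -> (forall i, F i * G i = 1) ->
  (forall i, G i * F i = 1) -> (\prod_(i <- s) F i) * (\prod_(i <- s) G i) = 1.
Proof.
move=> FF FG GF; elim: s => [|i s IHs]; first by rewrite !big_nil mulr1.
rewrite !big_cons -mulrA [_ * (G i * _)]mulrA.
have -> : (\prod_(j <- s) F j) * G i = G i * \prod_(j <- s) F j.
  apply/esym/commr_prod => j _; apply/commr_sym.
  exact: (comm_inv (GF i) (FG i)).
by rewrite -mulrA IHs mulr1 FG.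
Qed.

(** * Bethe matrix entries as sums over poles *)

Section BetheSymbols.
Variables (r : nat) (E : pzRingType) (iota : {rmorphism 'M[C]_r -> E}).
Variables (u ui v h : E) (d : nat).
Local Notation comm := GRing.comm.
Hypothesis hC : forall w, comm w h.
Hypothesis hnil : h ^+ d.+1 = 0.
Hypotheses (uK : u * ui = 1) (uiK : ui * u = 1).
Hypothesis iotau : forall a, comm (iota a) u.

Local Notation y := (h * ui).
Local Notation sc c := (iota c%:M).

(** For [u = h x] this is h (x - w), and [resolvent w] is the geometric series for its inverse. *)
Definition pole (w : C) : E := u - h * sc w.
Definition resolvent (w : C) : E := ui * \sum_(s < d.+1) (sc w * y) ^+ s.

Let scC w a : comm (sc w) (iota a).
Proof. by rewrite /comm -!rmorphM; congr (iota _); apply/esym/scalar_mxC. Qed.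

Let sc_ui w : comm (sc w) ui. Proof. exact: (comm_inv uiK uK). Qed.

Let sy_nil w : (sc w * y) ^+ d.+1 = 0.
Proof.
rewrite exprMn_comm; last exact: (iota_y hC uK uiK iotau).
by rewrite (y_nil ui hC hnil) // mulr0.
Qed.

Let pole_ui w : pole w * ui = 1 - sc w * y.
Proof. by rewrite /pole mulrBl uK -hC mulrA. Qed.

Lemma pole_resolvent w : pole w * resolvent w = 1.
Proof. by rewrite /resolvent mulrA pole_ui -opprB mulNr -subrX1 sy_nil sub0r opprK. Qed.

Lemma resolvent_pole w : resolvent w * pole w = 1.
Proof.
have poleE : pole w = (1 - sc w * y) * u by rewrite -pole_ui -mulrA uiK mulr1.
have yC : comm (sc w * y) (\sum_(s < d.+1) (sc w * y) ^+ s).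
  by apply: commr_sum => s _; apply/commrX.
rewrite poleE /resolvent -!mulrA [_ * ((1 - _) * u)]mulrA mulrBr mulr1 -yC.
rewrite -{1}[\sum_(s < d.+1) _]mul1r -mulrBl -opprB mulNr -subrX1 sy_nil sub0r opprK.
by rewrite mul1r.
Qed.

Variables (N p : nat) (beta : 'I_N -> C) (w : 'I_p -> C).
Variables (Em : 'I_N -> 'I_N -> nat -> 'M[C]_r) (Xi : 'I_p -> 'I_N -> 'I_N -> 'M[C]_r).
Hypothesis EmE : forall i j s, Em i j s = \sum_c (w c ^+ s) *: Xi c i j.

Local Notation B := (bethe_matrix (fun i => (beta i)%:M)).

(** The series of w^s x^(-s-1) sums to 1 / (x - w), that is [h * resolvent w]; the second factor [h]
    comes from scaling an operator of order one. *)
Lemma symop_bethe_matrix i j : symop iota ui v h d 1 (B Em i j) =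
  (if i == j then v - h * sc (beta i) else 0)
  - \sum_c resolvent (w c) * (h * h * iota (Xi c j i)).
Proof.
have hE : h * ser iota ui h d (ser_e Em j i) =
    \sum_c resolvent (w c) * (h * h * iota (Xi c j i)).
  have yiota a : comm (iota a) y by exact: (iota_y hC uK uiK iotau).
  have E1 : ser iota ui h d (ser_e Em j i) = \sum_(s < d.+1) iota (Em j i s) * y ^+ s.+1.
    rewrite [RHS]big_ord_recr /= (y_nil ui hC hnil) // mulr0 addr0.
    by rewrite /ser big_ord_recl rmorph0 mul0r add0r.
  rewrite E1; transitivity (\sum_c \sum_(s < d.+1) h * (sc (w c ^+ s) * iota (Xi c j i) * y ^+ s.+1)).
    rewrite mulr_sumr exchange_big; apply: eq_bigr => s _.
    rewrite EmE rmorph_sum mulr_suml mulr_sumr; apply: eq_bigr => c _.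
    by rewrite -rmorphM [_ * Xi c j i]mul_scalar_mx.
  apply: eq_bigr => c _; rewrite /resolvent -mulrA mulr_suml mulr_sumr.
  apply: eq_bigr => s _.
  have -> : sc (w c ^+ s) = sc (w c) ^+ s.
    by rewrite -rmorphXn; congr (iota _); elim: (nat_of_ord s) => // t IHt; rewrite !exprS -IHt scalar_mxM.
  rewrite [(sc (w c) * y) ^+ _]exprMn_comm; last exact: yiota.
  rewrite exprS.
  have ZY : comm (iota (Xi c j i)) (y ^+ s) by apply: commrX.
  have Zui : comm (iota (Xi c j i)) ui by exact: (comm_inv uiK uK).
  have uiS : comm ui (sc (w c) ^+ s) by apply: commrX; apply/commr_sym/sc_ui.
  move: (y ^+ s) (sc (w c) ^+ s) (iota _) ZY Zui uiS => Y S Z ZY Zui uiS.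
  have Zc : comm Z (ui * Y) by apply: commrM.
  rewrite -[LHS]hC -(mulrA h) -(hC (ui * Y)).
  have -> : h * h * Z = Z * (h * h) by rewrite -mulrA -(hC Z) mulrA -(hC Z) mulrA.
  rewrite -(mulrA S Y) [RHS]mulrA uiS -!mulrA; congr (S * _).
  by rewrite [LHS]mulrA Zui -mulrA [Z * (Y * _)]mulrA ZY -mulrA.
rewrite symop1 /bethe_matrix; case: eqP => _; last first.
  rewrite {2}/dcoef [X in _ + X](_ : _ = 0); last by rewrite ser0 ?mul0r // => l; rewrite dcoef_default.
  by rewrite addr0 sub0r -hE /dcoef /= serN mulNr hC.
rewrite [ser _ _ _ _ (dcoef _ 1)]serC //=; last by case.
rewrite /dcoef /= /sr1 eqxx rmorph1 mul1r addrC -addrA; congr (_ + _).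
rewrite serD serN mulrDl -hE mulNr; congr (_ - _); last by rewrite hC.
rewrite serC => [|l]; last by case: l.
by rewrite eqxx rmorphN mulNr hC.
Qed.

Lemma bethe_matrix_size i j : (size (B Em i j) <= 2)%N.
Proof. by rewrite /bethe_matrix; case: eqP. Qed.

Lemma regular_bethe_matrix (Sc : 'M[C]_r -> Prop) i j : (forall c, Sc c%:M) ->
  regular Sc 1 (B Em i j).
Proof.
move=> ScC; have Sc0 : Sc 0 by have := ScC 0; rewrite raddf0.
have Sc1 : Sc 1 by apply: ScC.
rewrite /bethe_matrix; case: eqP => _; split=> [[|[|m]] l //|[|[|m]]|l] //=;
  rewrite /dcoef /= ?nth_nil ?subr0 ?oppr0 // /sr1.
  by have := ScC (- beta i); rewrite raddfN.
by case: eqP.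
Qed.
End BetheSymbols.

(** * Equality of the two algebras *)

Section SymbolDuality.
Variables (k n : nat) (z : 'I_k -> C) (alpha : 'I_n -> C).
Variables (E : pzRingType) (iota : {rmorphism EndP k n -> E}).
Variables (x xi dd ddi h : E) (d : nat).
Local Notation comm := GRing.comm.
Hypothesis hC : forall w, comm w h.
Hypothesis hnil : h ^+ d.+1 = 0.
Hypotheses (xK : x * xi = 1) (xiK : xi * x = 1).
Hypotheses (ddK : dd * ddi = 1) (ddiK : ddi * dd = 1).
Hypothesis ddx : dd * x = x * dd + h * h.
Hypotheses (iotax : forall a, comm (iota a) x) (iotad : forall a, comm (iota a) dd).

Definition dop_n := drdet (bethe_matrix (fun i => (alpha i)%:M : EndP k n) (pi_n z)).
Definition dop_k := drdet (bethe_matrix (fun a => (z a)%:M : EndP k n) (pi_k alpha)).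
Definition scalar (A : EndP k n) := exists c : C, A = c%:M.

Let scalarP : [/\ scalar 0, scalar 1, forall A, scalar A -> scalar (- A),
  forall A B, scalar A -> scalar B -> scalar (A + B) &
  forall A B, scalar A -> scalar B -> scalar (A * B)].
Proof.
split=> [||A [a ->]|A B [a ->] [b ->]|A B [a ->] [b ->]].
- by exists 0; rewrite raddf0.
- by exists 1.
- by exists (- a); rewrite raddfN.
- by exists (a + b); rewrite raddfD.
by exists (a * b); rewrite scalar_mxM.
Qed.

Local Notation sc c := (iota c%:M).
Local Notation P i := (dd - h * sc (alpha i)).
Local Notation X a := (x - h * sc (z a)).
Local Notation Xi a := (resolvent iota xi h d (z a)).
Local Notation Pi i := (- resolvent iota (- ddi) h d (- alpha i)).

Let nddK : - dd * - ddi = 1. Proof. by rewrite mulrNN. Qed.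
Let nddiK : - ddi * - dd = 1. Proof. by rewrite mulrNN. Qed.
Let iotand a : comm (iota a) (- dd). Proof. exact: commrN. Qed.

(** The sign is the reason why the sum over [i] enters the gl_k matrix with a plus. *)
Let PE i : P i = - pole iota (- dd) h (- alpha i).
Proof. by rewrite /pole raddfN rmorphN mulrN opprK opprD opprK. Qed.

Let PK i : P i * Pi i = 1.
Proof. by rewrite PE mulrNN (pole_resolvent hC hnil nddK nddiK iotand). Qed.
Let PiK i : Pi i * P i = 1.
Proof. by rewrite PE mulrNN (resolvent_pole hC hnil nddK nddiK iotand). Qed.
Let XK a : X a * Xi a = 1. Proof. exact: (pole_resolvent hC hnil xK xiK iotax). Qed.
Let XiK a : Xi a * X a = 1. Proof. exact: (resolvent_pole hC hnil xK xiK iotax). Qed.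

Let scsc a b : comm (sc a) (sc b).
Proof. by rewrite /comm -!(rmorphM iota); congr (iota _); exact: scalar_mxC. Qed.
Let hsc w c : comm w (sc c) -> comm w (h * sc c).
Proof. by move=> wc; apply: commrM. Qed.
Let linC w a b : comm (sc a) w -> comm (sc b) w -> comm (w - h * sc a) (w - h * sc b).
Proof.
move=> aw bw; apply: commrB.
  by apply/commr_sym/commrB => //; apply/hsc/commr_sym.
apply/hsc/commr_sym/commrB => //; exact: hsc.
Qed.

Let PP i j : comm (P i) (P j). Proof. exact: linC. Qed.
Let XX a c : comm (X a) (X c). Proof. exact: linC. Qed.

Let PX i a : P i * X a = X a * P i + h * h.
Proof.
have E1 : dd * (h * sc (z a)) = h * sc (z a) * dd.
  exact/hsc/commr_sym/iotad.
have E2 : h * sc (alpha i) * x = x * (h * sc (alpha i)).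
  exact/esym/hsc/commr_sym/iotax.
have E3 : h * sc (alpha i) * (h * sc (z a)) = h * sc (z a) * (h * sc (alpha i)).
  by apply: hsc; apply/commr_sym/hsc.
rewrite !mulrBl !mulrBr ddx E1 E2 E3; abel.
Qed.

Let iotaP A i : comm (iota A) (P i).
Proof.
apply: commrB => //; apply: hsc; rewrite /comm -!(rmorphM iota); congr (iota _).
exact: scalar_mxC.
Qed.
Let iotaX A a : comm (iota A) (X a).
Proof.
apply: commrB => //; apply: hsc; rewrite /comm -!(rmorphM iota); congr (iota _).
exact: scalar_mxC.
Qed.

Local Notation Dop := (symop iota xi dd h d n dop_n).
Local Notation Nop := (symop iota (- ddi) x h d k dop_k).

Lemma dop_nP : regular scalar n dop_n /\ Dop = rdet (fun i j =>
  (if i == j then P i else 0) - \sum_a Xi a * (h * h * iota (xi_op (a, j) *m del_op (a, i)))).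
Proof.
have [s0 s1 sN sD sM] := scalarP.
have [||R ->] := @drdetP _ _ iota x xi dd h d hC hnil xK xiK ddx iotax iotad scalar
  s0 s1 sN sD sM n (bethe_matrix (fun i => (alpha i)%:M : EndP k n) (pi_n z)).
- by move=> i j; apply: bethe_matrix_size.
- by move=> i j; apply: regular_bethe_matrix => c; exists c.
split=> //; apply: eq_rdet => i j.
exact: (symop_bethe_matrix dd hC hnil xK xiK iotax alpha
  (Xi := fun a i j => xi_op (a, i) *m del_op (a, j))).
Qed.

Lemma dop_kP : regular scalar k dop_k /\ Nop = rdet (fun a c =>
  (if a == c then X a else 0) + \sum_i Pi i * (h * h * iota (xi_op (c, i) *m del_op (a, i)))).
Proof.
have [s0 s1 sN sD sM] := scalarP.
(* The substitution x -> - d/dx, d/dx -> x preserves the commutation relation, so the symbol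
   calculus applies to the substituted operator. *)
have xdd : x * - dd = - dd * x + h * h by rewrite mulrN mulNr ddx opprD addrNK.
have [||R ->] := @drdetP _ _ iota (- dd) (- ddi) x h d hC hnil nddK nddiK xdd iotand iotax
  scalar s0 s1 sN sD sM k (bethe_matrix (fun a => (z a)%:M : EndP k n) (pi_k alpha)).
- by move=> i j; apply: bethe_matrix_size.
- by move=> i j; apply: regular_bethe_matrix => c; exists c.
split=> //; apply: eq_rdet => a c.
rewrite (symop_bethe_matrix x hC hnil nddK nddiK iotand z (w := fun i => - alpha i)
  (Xi := fun i a b => xi_op (a, i) *m del_op (b, i))) //; congr (_ + _).
by rewrite -sumrN; apply: eq_bigr => i _; rewrite mulNr.
Qed.

Let Pbi := \prod_i Pi i.
Let PbK : (\prod_i P i) * Pbi = 1. Proof. exact: prod_inv. Qed.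
Let PbiK : Pbi * \prod_i P i = 1.
Proof.
apply: prod_inv => // i j; apply: (comm_inv (PiK j) (PK j)); apply/commr_sym.
exact: (comm_inv (PiK i) (PK i)).
Qed.

Lemma symop_duality : Dop * Pbi * Nop = \prod_a X a.
Proof.
rewrite dop_nP.2 dop_kP.2.
exact: (fermionic_duality hC PK PiK XK XiK PbK PbiK PP XX PX iotaP iotaX).
Qed.

Variable O : E -> Prop.
Hypotheses (O1 : O 1) (OB : forall a b, O a -> O b -> O (a - b)).
Hypothesis OM : forall a b, O a -> O b -> O (a * b).
Hypotheses (Ox : O x) (Oxi : O xi) (Odd : O dd) (Oddi : O ddi) (Oh : O h).
Hypothesis Osc : forall c, O (sc c).

Let O_prodP : O (\prod_i P i).
Proof. by apply: subring_prod => // i; apply: OB => //; apply: OM. Qed.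
Let O_prodX : O (\prod_a X a).
Proof. by apply: subring_prod => // i; apply: OB => //; apply: OM. Qed.

Let inv_exp (u v : E) m : u * v = 1 -> v * u = 1 -> u ^+ m * v ^+ m = 1.
Proof. by move=> uv vu; rewrite -exprMn_comm ?uv ?expr1n // /comm uv vu. Qed.

(** Modulo [h], [Nop] is the unit [x ^ k], so its inverse stays in [O] and the duality can be solved
    for [Dop]. [O] will be the set of operators compatible with the Bethe algebra of gl_k. *)
Lemma dop_n_of_dop_k : O Nop -> O Dop.
Proof.
move=> ON; have [B NE] : exists B, Nop = x ^+ k + h * B.
  rewrite dop_kP.2; apply: rdet_pert => // a c.
  exists ((if a == c then - sc (z a) else 0) +
    \sum_i Pi i * (h * iota (xi_op (c, i) *m del_op (a, i)))).
  rewrite mulrDr addrA mulr_sumr; congr (_ + _).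
    by case: eqP => _; rewrite ?mulr0 ?addr0 // mulrN.
  by apply: eq_bigr => i _; rewrite [RHS]mulrA -(hC (Pi i)) -!mulrA.
have [N' [ON' NN' _]] := unit_pert hC hnil O1 OB OM
  (inv_exp k xK xiK) (inv_exp k xiK xK) (subring_exp O1 OM k Oxi) ON NE.
have -> : Dop = (\prod_a X a) * N' * \prod_i P i.
  by rewrite -symop_duality -!mulrA [Nop * _]mulrA NN' mul1r PbiK mulr1.
by do 2!apply: OM => //.
Qed.

Lemma dop_k_of_dop_n : O Dop -> O Nop.
Proof.
move=> OD; have [B DE] : exists B, Dop = dd ^+ n + h * B.
  rewrite dop_nP.2; apply: rdet_pert => // i j.
  exists ((if i == j then - sc (alpha i) else 0) -
    \sum_a Xi a * (h * iota (xi_op (a, j) *m del_op (a, i)))).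
  rewrite mulrBr addrA mulr_sumr; congr (_ - _).
    by case: eqP => _; rewrite ?mulr0 ?addr0 // mulrN.
  by apply: eq_bigr => a _; rewrite [RHS]mulrA -(hC (Xi a)) -!mulrA.
have [D' [OD' _ DD']] := unit_pert hC hnil O1 OB OM
  (inv_exp n ddK ddiK) (inv_exp n ddiK ddK) (subring_exp O1 OM n Oddi) OD DE.
have -> : Nop = (\prod_i P i) * D' * \prod_a X a.
  by rewrite -symop_duality !mulrA -(mulrA _ D') DD' mulr1 PbK mul1r.
by do 2!apply: OM => //.
Qed.
End SymbolDuality.

(** * Recovering coefficients from the action on arrays *)

Section CoefficientExtraction.
Variables (R : pzRingType) (d : nat).
Local Notation comm := GRing.comm.
Local Notation oper := (oper R d).
Local Notation h := (hop R d).
Local Notation iota := (@iota_op R d).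
Local Notation u := (shift_op R d 1 0).
Local Notation ui := (shift_op R d (-1) 0).
Local Notation J := (shift_op R d 0 1).
Local Notation Ji := (shift_op R d 0 (-1)).

(* Left multiplication by [h * d/dx]; left multiplication by [h * x] is
   [shift_op 1 0]. *)
Definition vop : oper := J + h * (h * diff_op R d).

Lemma shift_uK : u * ui = 1. Proof. by rewrite shift_opM shift_op0. Qed.
Lemma shift_uiK : ui * u = 1. Proof. by rewrite shift_opM shift_op0. Qed.
Lemma shift_JK : J * Ji = 1. Proof. by rewrite shift_opM shift_op0. Qed.
Lemma shift_JiK : Ji * J = 1. Proof. by rewrite shift_opM shift_op0. Qed.

Lemma vop_shift : vop * u = u * vop + h * h.
Proof.
rewrite mulrDl mulrDr !shift_opM addr0 add0r -addrA; congr (_ + _).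
have uh : u * h = h * u := hop_comm u.
rewrite -!mulrA diff_shift shift_op0 !mulrDr mulr1; congr (_ + _).
by rewrite [RHS]mulrA uh -mulrA [u * (h * _)]mulrA uh -mulrA.
Qed.

Lemma iota_shift a p q : comm (iota a) (shift_op R d p q).
Proof. exact: oper_eq. Qed.

Lemma iota_vop a : comm (iota a) vop.
Proof.
apply: commrD; first exact: iota_shift.
apply: commrM; first exact: hop_comm.
apply: commrM; first exact: hop_comm.
by apply: oper_eq => f i j l; rewrite /= mulrzAr.
Qed.

Definition basis0 m : lfun R := fun i j l =>
  if [&& i == 0, j == m%:Z & l == 0%N] then 1 else 0.

(** The derivative term of [vop] vanishes on symbols free of h x. *)
Lemma vop_basis m : (vop ^+ m : oper) (basis0 0) = basis0 m.
Proof.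
elim: m => // m IHm; rewrite exprS op_mulE IHm.
apply: funext => i; apply: funext => j; apply: funext => l.
have D0 : diff_op R d (basis0 m) = fun _ _ _ => 0.
  apply: funext => i'; apply: funext => j'; apply: funext => l'; rewrite /= /basis0.
  by case: eqP => [->|_] /=; rewrite ?mulr0z ?mul0rz.
have h0 : h (fun _ _ _ => 0) = fun _ _ _ => 0.
  apply: funext => i'; apply: funext => j'; apply: funext => l'.
  by case: l' => //= l'; case: ifP.
have -> : vop (basis0 m) i j l = J (basis0 m) i j l + h (h (diff_op R d (basis0 m))) i j l by [].
by rewrite D0 !h0 addr0 /= /basis0 subr0 subr_eq intS [1 + _]addrC.
Qed.

Lemma ui_expE m f i j l : (ui ^+ m : oper) f i j l = f (i + m%:Z) j l.
Proof.
elim: m i => [|m IHm] i; first by rewrite addr0.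
have -> : (ui ^+ m.+1 : oper) f i j l = (ui ^+ m : oper) f (i + 1) j l.
  by rewrite exprS op_mulE /= opprK subr0.
by rewrite IHm -addrA intS.
Qed.

(** On the symbol 1, a term B x^-j (d/dx)^m scaled by h^N gives B h^(j + N - m) (h x)^-j (h d/dx)^m.
    The exponents determine [j] and [m], and [j + N <= d] keeps the power of [h] within range. *)
Lemma symop_extract N (Q : dop R) m j : (m <= N)%N -> (j + N <= d)%N ->
  symop iota ui vop h d N Q (basis0 0) (- j%:Z) m%:Z (j + (N - m))%N = dcoef Q m j.
Proof.
move=> mN jN; rewrite /symop op_sum.
pose l := (j + (N - m))%N; have ld : (l <= d)%N.
  by apply: leq_trans jN; rewrite leq_add2l leq_subr.
have E (m' : 'I_N.+1) : (ser iota ui h d (dcoef Q m') * h ^+ (N - m') * vop ^+ m' : oper)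
    (basis0 0) (- j%:Z) m%:Z l = if m' == m :> nat then dcoef Q m j else 0.
  have -> : (ser iota ui h d (dcoef Q m') * h ^+ (N - m') * vop ^+ m' : oper) (basis0 0) =
      (ser iota ui h d (dcoef Q m') : oper) ((h ^+ (N - m') : oper) (basis0 m')).
    by rewrite !op_mulE vop_basis.
  rewrite /ser op_sum.
  have T (j' : 'I_d.+1) : (iota (dcoef Q m' j') * (h * ui) ^+ j' : oper)
      ((h ^+ (N - m') : oper) (basis0 m')) (- j%:Z) m%:Z l =
      if (m' == m :> nat) && (j' == j :> nat) then dcoef Q m j else 0.
    rewrite y_exp; last exact: hop_comm.
    rewrite !op_mulE [LHS]/= hop_expE // ui_expE.
    have jj : (- j%:Z + j'%:Z == 0) = (j' == j :> nat).
      by rewrite addrC subr_eq0 eqz_nat.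
    case: leqP => jl; last first.
      rewrite mulr0; case: andP => // -[_ /eqP jE].
      by move: jl; rewrite jE /l; lia.
    rewrite hop_expE; last by apply: leq_trans ld; apply: leq_subr.
    rewrite /basis0 jj eqz_nat.
    case: (eqVneq (m' : nat) m) => [mE|mE]; last first.
      by rewrite /= andbF; case: ifP; rewrite mulr0.
    rewrite mE; case: (eqVneq (j' : nat) j) => [jE|_] /=; last by case: ifP; rewrite mulr0.
    by rewrite jE /l addKn leqnn subnn eqxx mulr1.
  rewrite (eq_bigr _ (fun j' _ => T j')); case: eqP => _; last by rewrite big1.
  have jd : (j < d.+1)%N by rewrite ltnS (leq_trans _ jN) ?leq_addr.
  by rewrite (bigD1 (Ordinal jd)) //= eqxx big1 ?addr0 // => j' jj; rewrite ifN.
rewrite (eq_bigr _ (fun m' _ => E m')) (bigD1 (Ordinal (mN : m < N.+1)%N)) //=.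
by rewrite eqxx big1 ?addr0 // => m' mm; rewrite ifN.
Qed.

Variable S : R -> Prop.
Hypotheses (S1 : S 1) (SB : forall a b, S a -> S b -> S (a - b)).
Hypothesis SM : forall a b, S a -> S b -> S (a * b).

(** Turns membership of all coefficients in [S] into a condition closed under products and under the
    geometric series for inverses. *)
Definition preserves (T : oper) := forall f,
  (forall i j l, S (f i j l)) -> forall i j l, S (T f i j l).

Let S0 : S 0. Proof. by rewrite -(subrr 1); apply: SB. Qed.

Let Smulz a m : S a -> S (a *~ m).
Proof.
move=> Sa; have Sn p : S (a *+ p).
  by elim: p => // p IHp; rewrite mulrS; apply: subring_add.
case: m => p; first exact: Sn.
by rewrite NegzE mulrNz -sub0r; apply: SB => //; apply: Sn.
Qed.

Lemma preserves1 : preserves 1. Proof. by []. Qed.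
Lemma preservesB T U : preserves T -> preserves U -> preserves (T - U).
Proof. by move=> pT pU f Sf i j l; apply: SB; [apply: pT|apply: pU]. Qed.
Lemma preservesM T U : preserves T -> preserves U -> preserves (T * U).
Proof. by move=> pT pU f Sf i j l; apply/pT/pU. Qed.
Lemma preserves_shift p q : preserves (shift_op R d p q).
Proof. by move=> f Sf i j l; apply: Sf. Qed.
Lemma preserves_h : preserves h.
Proof. by move=> f Sf i j [|l] //=; case: ifP. Qed.
Lemma preserves_iota a : S a -> preserves (iota a).
Proof. by move=> Sa f Sf i j l; apply: SM. Qed.
Lemma preserves_vop : preserves vop.
Proof.
apply: (subring_add preserves1 preservesB); first exact: preserves_shift.
do 2![apply: preservesM; first exact: preserves_h].
by move=> f Sf i j l; apply: Smulz.
Qed.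

Lemma vop_inv : exists vi : oper, [/\ preserves vi, vop * vi = 1 & vi * vop = 1].
Proof.
apply: (unit_pert (hop_comm (d := d)) (hop_nil R d) preserves1 preservesB preservesM
  shift_JK shift_JiK (preserves_shift 0 (-1)) preserves_vop).
by [].
Qed.

Lemma preserves_symop (ui' v' : oper) N Q : preserves ui' -> preserves v' ->
  (forall m j, S (dcoef Q m j)) -> preserves (symop iota ui' v' h d N Q).
Proof.
move=> pu pv SQ; have pE := subring_exp preserves1 preservesM.
apply: (subring_sum preserves1 preservesB) => m.
apply: preservesM; last exact: pE.
apply: preservesM; last exact/pE/preserves_h.
apply: (subring_sum preserves1 preservesB) => j; apply: preservesM; first exact: preserves_iota.
by apply/pE/preservesM => //; apply: preserves_h.
Qed.

Lemma preserves_extract N Q m j : preserves (symop iota ui vop h d N Q) ->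
  (m <= N)%N -> (j + N <= d)%N -> S (dcoef Q m j).
Proof.
move=> pQ mN jN; rewrite -(symop_extract Q mN jN); apply: pQ => i' j' l'.
by rewrite /basis0; case: ifP.
Qed.
End CoefficientExtraction.

(** * The two inclusions between the generated algebras *)

Section GeneratedAlgebras.
Variables (k n : nat) (z : 'I_k -> C) (alpha : 'I_n -> C).
Local Notation gens_n := (bethe_gens (fun i : 'I_n => ((alpha i)%:M : EndP k n)) (pi_n z)).
Local Notation gens_k := (bethe_gens (fun a : 'I_k => ((z a)%:M : EndP k n)) (pi_k alpha)).

Let algB (G : EndP k n -> Prop) A B : gen_alg G A -> gen_alg G B -> gen_alg G (A - B).
Proof. by move=> GA GB; rewrite -scaleN1r; apply: ga_add => //; apply: ga_scale. Qed.

Let alg_scalar (G : EndP k n -> Prop) A : scalar A -> gen_alg G A.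
Proof. by case=> c ->; rewrite -scalemx1; apply/ga_scale/ga_one. Qed.

Let alg_regular N (Q : dop (EndP k n)) (G : EndP k n -> Prop) :
  regular (@scalar k n) N Q ->
  (forall m j, (m < N)%N -> (0 < j)%N -> G (dcoef Q m j)) ->
  forall m j, gen_alg G (dcoef Q m j).
Proof.
move=> [Q0 QS QT] GQ m j; case: (ltngtP m N) => [mN|mN|->].
- by case: j => [|j]; [exact: alg_scalar|apply/ga_gen/GQ].
- by rewrite Q0 // -(scale0r 1%:M); apply/ga_scale/ga_one.
exact: alg_scalar.
Qed.

Lemma gens_n_sub A : gens_n A -> gen_alg gens_k A.
Proof.
(* The truncation order that [symop_extract] requires for the index [j] in an operator of order
   [n]. *)
case=> i [j [/andP[i0 iN] j0 ->]]; pose d := (j + n)%N.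
pose R := EndP k n; pose S := gen_alg gens_k.
have S1 : S 1 by apply: ga_one.
have SB := @algB gens_k; have SM := @ga_mul _ gens_k.
have [vi [pvi vK viK]] := @vop_inv R d S S1 SB.
have hC := @hop_comm R d; have hnil := hop_nil R d.
have uK := shift_uK R d; have uiK := shift_uiK R d.
have vu := vop_shift R d.
have iu (a : R) := @iota_shift R d a 1 0; have iv := @iota_vop R d.
have Sc (c : C) : S c%:M by apply: alg_scalar; exists c.
have pN : preserves S (symop (@iota_op R d) (- vi) (shift_op R d 1 0) (hop R d) d k (dop_k z alpha)).
  apply: preserves_symop => //.
  - by rewrite -sub0r -(subrr 1); do 2!apply: preservesB => //.
  - exact: preserves_shift.
  apply: (alg_regular (dop_kP z alpha hC hnil vK viK vu iu iv).1) => m l mk l0.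
  exists (k - m)%N, l; split=> //; first by lia.
  by rewrite /bethe_coeff subKn // ltnW.
have pD := @dop_n_of_dop_k k n z alpha _ _ _ _ _ _ _ _ hC hnil uK uiK vK viK vu iu iv
  (preserves S) (@preserves1 _ _ S) (@preservesB R d S SB) (@preservesM _ _ S)
  (@preserves_shift _ _ S 1 0) (@preserves_shift _ _ S (-1) 0) (preserves_vop d S1 SB)
  (preserves_h d S1 SB) (fun c => preserves_iota d SM (Sc c)) pN.
exact: (preserves_extract S1 SB pD (leq_subr _ _)).
Qed.

(** Extraction reads operators in h x and h d/dx themselves, whereas the duality contains the gl_k
    operator after the substitution. It is therefore applied to the pair [vop], [- u] in place of h
    x, h d/dx: this undoes the substitution on the gl_k side and moves it to the gl_n side. *)
Lemma gens_k_sub A : gens_k A -> gen_alg gens_n A.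
Proof.
case=> i [j [/andP[i0 iN] j0 ->]]; pose d := (j + k)%N.
pose R := EndP k n; pose S := gen_alg gens_n.
have S1 : S 1 by apply: ga_one.
have SB := @algB gens_n; have SM := @ga_mul _ gens_n.
have [vi [pvi vK viK]] := @vop_inv R d S S1 SB.
have hC := @hop_comm R d; have hnil := hop_nil R d.
pose u := shift_op R d 1 0; pose ui := shift_op R d (-1) 0.
have uK : - u * - ui = 1 by rewrite mulrNN shift_uK.
have uiK : - ui * - u = 1 by rewrite mulrNN shift_uiK.
have vu : - u * vop R d = vop R d * - u + hop R d * hop R d.
  by rewrite mulrN mulNr vop_shift opprD addrNK.
have iu (a : R) : GRing.comm (iota_op d a) (- u) by apply: commrN; apply: iota_shift.
have iv := @iota_vop R d.
have Sc (c : C) : S c%:M by apply: alg_scalar; exists c.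
have pN w : preserves S w -> preserves S (- w : oper R d).
  move=> pw; rewrite -sub0r -(subrr 1).
  by apply: preservesB => //; apply: preservesB.
have pD : preserves S (symop (@iota_op R d) vi (- u) (hop R d) d n (dop_n z alpha)).
  apply: preserves_symop => //; first by apply: pN; apply: preserves_shift.
  apply: (alg_regular (dop_nP z alpha hC hnil vK viK vu iv iu).1) => m l mk l0.
  exists (n - m)%N, l; split=> //; first by lia.
  by rewrite /bethe_coeff subKn // ltnW.
have := @dop_k_of_dop_n k n z alpha _ _ _ _ _ _ _ _ hC hnil vK viK uK uiK vu iv iu
  (preserves S) (@preserves1 _ _ S) (@preservesB R d S SB) (@preservesM _ _ S)
  (preserves_vop d S1 SB) (pN _ (@preserves_shift _ _ S 1 0))
  (pN _ (@preserves_shift _ _ S (-1) 0))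
  (preserves_h d S1 SB) (fun c => preserves_iota d SM (Sc c)) pD.
rewrite opprK => pK.
exact: (preserves_extract S1 SB pK (leq_subr _ _)).
Qed.
End GeneratedAlgebras.

Lemma gen_alg_sub r (G H : 'M[C]_r -> Prop) A :
  (forall B, G B -> gen_alg H B) -> gen_alg G A -> gen_alg H A.
Proof.
move=> GH; elim=> {A} [A /GH//||A B _ HA _ HB|c A _ HA|A B _ HA _ HB].
- exact: ga_one.
- exact: ga_add.
- exact: ga_scale.
exact: ga_mul.
Qed.

Theorem theorem5p2 (k n : nat) (hk : (0 < k)%N) (hn : (0 < n)%N)
    (z : 'I_k -> C) (alpha : 'I_n -> C)
    (hz : injective z) (halpha : injective alpha) :
  forall X : EndP k n,
    gen_alg (bethe_gens (fun i : 'I_n => ((alpha i)%:M : EndP k n)) (pi_n z)) X <->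
    gen_alg (bethe_gens (fun a : 'I_k => ((z a)%:M : EndP k n)) (pi_k alpha)) X.
Proof.
by move=> X; split; apply: gen_alg_sub => A; [apply: gens_n_sub|apply: gens_k_sub].
Qed.
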